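(* Let $G$ be a countably infinite group acting by homeomorphisms on a compact metrizable space $X$, and let $G\curvearrowright \mathcal{M}(X)$ be the induced action by push-forwards on the space $\mathcal{M}(X)$ of Borel probability measures on $X$ with the weak$^*$-topology. Then the following are equivalent: \begin{enumerate} \item $G\curvearrowright X$ is not tame; \item $G\curvearrowright \mathcal{M}(X)$ is not tame; \item $\mathrm{IT}_k(\mathcal{M}(X),G)\setminus \Delta_k^2(\mathcal{M}(X))\neq\emptyset$ for every integer $k\geq 2$. \end{enumerate}
   Context: Let $G\curvearrowright Z$ be an action of $G$ by homeomorphisms on a compact metrizable space $Z$. Tameness: the Ellis semigroup $E(G\curvearrowright Z)$ is the closure of $\{z\mapsto gz: g\in G\}\subset Z^Z$ in the product topology. The action is tame if the cardinality of $E(G\curvearrowright Z)$ is at most $2^{\aleph_0}$. Independence sets: for a tuple $\mathbf{A}=(A_1,\dots,A_k)$ of subsets of $Z$, a set $J\subset G$ is an independence set for $\mathbf{A}$ if for every non-empty finite $I\subset J$ and every function $\phi:I\to\{1,\dots,k\}$ one has $\bigcap_{s\in I}s^{-1}A_{\phi(s)}\neq\emptyset$. IT-tuples: for $k\geq 1$, a tuple $(z_1,\dots,z_k)\in Z^k$ is an IT-tuple if for every product neighborhood $U_1\times\cdots\times U_k$ of $(z_1,\dots,z_k)$ the tuple $(U_1,\dots,U_k)$ has an infinite independence set. The set of IT-tuples of length $k$ is denoted $\mathrm{IT}_k(Z,G)$. Diagonal: $\Delta^2_k(Z)=\{(z_1,\dots,z_k)\in Z^k: \text{there exist } n\neq m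 \text{ in } \{1,\dots,k\} \text{ such that } z_n=z_m\}$. Induced action: the weak$^*$-topology on $\mathcal{M}(X)$ is the smallest topology making $\mu\mapsto\int_X f\,d\mu$ continuous for every continuous $f:X\to\mathbb{R}$; with it $\mathcal{M}(X)$ is compact and metrizable. The action $G\curvearrowright\mathcal{M}(X)$ is given by push-forward: $(g\mu)(A)=\mu(g^{-1}A)$ for $g\in G$, $\mu\in\mathcal{M}(X)$ and $A\subset X$ Borel. *)

(* Defs.v *)
From HB Require Import structures.
From mathcomp Require Import all_boot all_order all_algebra.
From mathcomp Require Import all_classical all_reals all_analysis.
From mathcomp Require Import measurable_realfun.

Set Implicit Arguments.
Unset Strict Implicit.
Unset Printing Implicit Defensive.

Import Order.TTheory GRing.Theory Num.Theory.
Import numFieldNormedType.Exports.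

Local Open Scope classical_set_scope.
Local Open Scope ring_scope.
Local Open Scope card_scope.

Definition metrizable (R : realType) (X : topologicalType) : Prop :=
  exists m : Metric R X, @open (Metric.Pack m) = @open X.

(* Since every [action a g] is continuous with inverse [action a g^-1], every
   translation is a homeomorphism. *)
Record homeo_action (G : groupType) (Z : topologicalType) := HomeoAction {
  action :> G -> Z -> Z;
  action1 : forall z, action 1%g z = z;
  actionM : forall g h z, action (g * h)%g z = action g (action h z);
  action_continuous : forall g, continuous (action g)
}.

Section Actions.
Context (G : groupType) (Z : topologicalType) (a : homeo_action G Z).

Lemma actionK g : cancel (a g) (a g^-1%g).
Proof. by move=> z; rewrite -actionM mulVg action1. Qed.

Lemma actionVK g : cancel (a g^-1%g) (a g).
Proof. by move=> z; rewrite -actionM mulgV action1. Qed.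

(* The translate g^-1 A is written [a g @^-1` A] below. *)
Lemma preimage_action g (A : set Z) : a g @^-1` A = a g^-1%g @` A.
Proof.
apply/seteqP; split => [z Az|_ [z Az <-]] /=; last by rewrite actionVK.
by exists (a g z) => //; rewrite actionK.
Qed.

Definition ellis_semigroup : set {ptws Z -> Z} :=
  closure (range (fun g => a g : {ptws Z -> Z})).

Definition tame : Prop := ellis_semigroup #<= [set: nat -> bool].

(* The values of [phi] outside [I] are irrelevant. *)
Definition independence_set (k : nat) (A : 'I_k -> set Z) (J : set G) : Prop :=
  forall I : set G, finite_set I -> I !=set0 -> I `<=` J ->
  forall phi : G -> 'I_k, \bigcap_(s in I) (a s @^-1` A (phi s)) !=set0.

Definition IT (k : nat) : set ('I_k -> Z) :=
  [set z | forall U : 'I_k -> set Z, (forall i, nbhs (z i) (U i)) ->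
     exists2 J : set G, infinite_set J & independence_set U J].

End Actions.

Arguments IT {G Z} a k.

Definition Delta2 (k : nat) (Z : Type) : set ('I_k -> Z) :=
  [set z | exists n m : 'I_k, n <> m /\ z n = z m].

Arguments Delta2 k Z : clear implicits.

Definition borel (X : ptopologicalType) := g_sigma_algebraType (@open X).

(* A [probability] is a function on all subsets, constrained on measurable ones
   only, so distinct terms may represent the same Borel measure.  Requiring the
   value 0 off the Borel sets selects one representative of each measure; see
   [prob_measure_ext] and [prob_measure_of]. *)
Record prob_measure (R : realType) (X : ptopologicalType) := ProbMeasure {
  prob_measure_val :> probability (borel X) R;
  prob_measure_out : forall A : set (borel X),
    ~ measurable A -> prob_measure_val A = 0%E
}.

Section ProbMeasure.
Context (R : realType) (X : ptopologicalType).
Local Notation M := (prob_measure R X).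

HB.instance Definition _ := gen_eqMixin M.
HB.instance Definition _ := gen_choiceMixin M.

Lemma prob_measure_ext (mu nu : M) :
  (forall A : set (borel X), measurable A -> mu A = nu A) -> mu = nu.
Proof.
case: mu nu => [mu mu0] [nu nu0] /= munu.
have {}munu : mu = nu :> (set (borel X) -> \bar R).
  apply/funext => A; have [/munu //|nA] := pselect (measurable A).
  by rewrite mu0 // nu0.
have E : mu = nu.
  case: mu nu munu {mu0 nu0} => [mu cmu] [nu cnu] /= munu; subst nu.
  congr Probability.Pack.
  case: cmu cnu => [[p1 p2] [p3] [p4] [p5] [p6] [p7] [p8]].
  case=> [[q1 q2] [q3] [q4] [q5] [q6] [q7] [q8]].
  have E1 := Prop_irrelevance p1 q1; have E2 := Prop_irrelevance p2 q2.
  subst q1 q2.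
  have E3 := Prop_irrelevance p3 q3; have E4 := Prop_irrelevance p4 q4.
  have E5 := Prop_irrelevance p5 q5; have E6 := Prop_irrelevance p6 q6.
  have E7 := Prop_irrelevance p7 q7; have E8 := Prop_irrelevance p8 q8.
  by subst.
subst nu; congr ProbMeasure; exact: Prop_irrelevance.
Qed.

(* For compact X every continuous f is bounded, so the real-valued integral
   takes no junk value. *)
Definition weak_star_topology : Type :=
  sup_topology (fun f : continuousType X R =>
    Topological.class (initial_topology (fun mu : M => \int[mu]_x f x))).

HB.instance Definition _ := Topological.copy M weak_star_topology.

(* Every Borel probability measure has a representative in [prob_measure]. *)
Section representative.
Variable P : probability (borel X) R.
Local Open Scope ereal_scope.

Definition borel_part (A : set (borel X)) : \bar R :=
  if `[< measurable A >] then P A else 0.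

Let borel_partE A : measurable A -> borel_part A = P A.
Proof. by rewrite /borel_part => mA; case: asboolP. Qed.

Let borel_part0 : borel_part set0 = 0.
Proof. by rewrite borel_partE// measure0. Qed.

Let borel_part_ge0 A : 0 <= borel_part A.
Proof. by rewrite /borel_part; case: ifP. Qed.

Let borel_part_sigma_additive : semi_sigma_additive borel_part.
Proof.
move=> F mF tF mUF; rewrite borel_partE//.
under eq_fun do under eq_bigr do rewrite borel_partE//.
exact: measure_semi_sigma_additive.
Qed.

HB.instance Definition _ := isMeasure.Build _ _ _ borel_part
  borel_part0 borel_part_ge0 borel_part_sigma_additive.

Let borel_partT : borel_part setT = 1.
Proof. by rewrite borel_partE// probability_setT. Qed.

HB.instance Definition _ := Measure_isProbability.Build _ _ _
  borel_part borel_partT.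

Lemma borel_part_out (A : set (borel X)) : ~ measurable A -> borel_part A = 0.
Proof. by rewrite /borel_part; case: asboolP. Qed.

Definition prob_measure_of : M :=
  @ProbMeasure R X borel_part borel_part_out.

Lemma prob_measure_ofE A : measurable A -> prob_measure_of A = P A.
Proof. exact: borel_partE. Qed.

End representative.

End ProbMeasure.

Section PushForward.
Context (R : realType) (G : groupType) (X : ptopologicalType).
Context (a : homeo_action G X).
Local Notation M := (prob_measure R X).

Lemma measurable_action g :
  measurable_fun [set: borel X] (a g : borel X -> borel X).
Proof.
apply: (@measurability _ _ (borel X) (borel X) setT (a g) (@open X) erefl).
move=> _ [B oB <-]; rewrite setTI; apply: sub_sigma_algebra.
by have /continuousP := @action_continuous _ _ a g; exact.
Qed.

HB.instance Definition _ g :=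
  isMeasurableFun.Build _ _ _ _ (a g : borel X -> borel X)
    (measurable_action g).

Lemma push_out (g : G) (mu : M) (A : set (borel X)) :
  ~ measurable A ->
  distribution mu (a g : borel X -> borel X) A = 0%E.
Proof.
move=> nA; apply: prob_measure_out; apply: contra_not nA => mA.
have -> : A = a g^-1%g @^-1` (a g @^-1` A).
  by apply/seteqP; split=> x /=; rewrite actionVK.
by rewrite -[X in measurable X]setTI; exact: measurable_action.
Qed.

Definition push (g : G) (mu : M) : M := ProbMeasure (@push_out g mu).

Lemma pushE g mu (A : set X) : push g mu A = mu (a g^-1%g @` A).
Proof. by rewrite -preimage_action. Qed.

Lemma push1 mu : push 1%g mu = mu.
Proof.
apply: prob_measure_ext => A mA; rewrite pushE; congr (prob_measure_val mu _).
rewrite invg1; apply/seteqP; split=> [_ [x Ax <-]|x Ax].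
  by rewrite action1.
by exists x => //; rewrite action1.
Qed.

Lemma pushM g h mu : push (g * h)%g mu = push g (push h mu).
Proof.
apply: prob_measure_ext => A mA /=; rewrite /distribution /pushforward /=.
congr (prob_measure_val mu _).
by apply/seteqP; split=> x /=; rewrite actionM.
Qed.

Lemma measurable_continuous (f : X -> R) :
  continuous f -> measurable_fun [set: borel X] (f : borel X -> R).
Proof.
move=> /continuousP cf.
apply: (measurability _ (RGenOpens.measurableE R)).
move=> _ [_ [x [y ->]] <-]; rewrite setTI; apply: sub_sigma_algebra.
exact/cf/interval_open.
Qed.

Lemma Rintegral_push g (mu : M) (f : X -> R) : continuous f ->
  \int[push g mu]_x f x = \int[mu]_x f (a g x).
Proof.
move=> /measurable_continuous mf; rewrite /Rintegral; congr fine.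
have mfE : measurable_fun [set: borel X] (EFin \o f : borel X -> \bar R).
  exact/measurable_EFinP.
have pf (h : X -> \bar R) : measurable_fun [set: borel X] (h : borel X -> _) ->
    (forall x, 0 <= h x)%E ->
    (\int[push g mu]_x h x = \int[mu]_x h (a g x))%E.
  move=> mh h0; rewrite -[in RHS](preimage_setT (a g)).
  exact: (ge0_integral_pushforward (measurable_action g)).
rewrite integralE [RHS]integralE; congr (_ - _)%E.
  rewrite pf//; last exact: measurable_funepos.
  by apply: eq_integral => x _; rewrite !funeposE.
rewrite pf//; last exact: measurable_funeneg.
by apply: eq_integral => x _; rewrite !funenegE.
Qed.

Lemma integral_continuous (f : continuousType X R) :
  continuous (fun mu : M => \int[mu]_x f x).
Proof.
move=> mu; pose I (h : continuousType X R) (nu : M) := \int[nu]_x h x.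
apply: cvg_trans (@initial_continuous M R (I f) mu); apply: cvg_app.
have /(@cvg_sup M _ (fun h => Topological.class (initial_topology (I h)))) :
  nbhs mu --> mu by [].
exact.
Qed.

Lemma push_continuous g : continuous (push g).
Proof.
move=> mu; have FF := fmap_filter (push g) (nbhs_filter mu).
apply: (@cvg_sup M _ _ _ (push g mu) FF).2 => f.
apply: continuous_comp_initial => {FF mu} mu /=.
pose fg := [the continuousType X R of f \o mkcts (@action_continuous _ _ a g)].
rewrite /comp (_ : (fun nu : M => _) = (fun nu : M => \int[nu]_x fg x)).
  exact: integral_continuous.
by apply/funext => nu; rewrite Rintegral_push//; exact: cts_fun.
Qed.

Definition push_action : homeo_action G M :=
  HomeoAction push1 pushM push_continuous.

End PushForward.

(* Main.v *)
(* All three conditions are equivalent to independence on X: there are f in C(X)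
   and p < q such that ({f < p}, {f > q}) has an infinite independence set.

   If there is none, every element e of the Ellis semigroup is coded by
   countable data.  Indeed {f o e > q} and {f o e < p} are separated by a
   countable union of locally closed sets, as otherwise both are dense in some
   closed set, and the translates of f that approximate f o e on finite sets
   build an independence tree there.  So the semigroup has cardinality at most
   that of the continuum.  The same coding works on M(X), with the functions
   mu |-> int f dmu, and independence of these functions descends to X: by
   Rosenthal's dichotomy, if f has no independence on X then some subsequence
   of any sequence of translates of f converges pointwise, hence its integrals
   converge.

   Conversely an infinite independence set for two disjoint closed sets of a
   compact space and an independent family of continuum many subsets of the
   integers produce 2^(2^aleph_0) limits of translations.  Independence on X
   localizes at two distinct points x and y, and the measures
   ((k - i) delta_x + i delta_y) / k, for i < k, then form an IT-tuple.

   M(X) is compact: the ultrafilter limit of measures is a finitely additive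
   content, whose inner regularization on open sets extends to a measure. *)

Require Import Defs.
From HB Require Import structures.
From mathcomp Require Import all_boot all_order all_algebra.
From mathcomp Require Import all_classical all_reals all_analysis.
From mathcomp Require Import measurable_realfun.
From mathcomp Require Import zify lra ring.

Set Implicit Arguments.
Unset Strict Implicit.
Unset Printing Implicit Defensive.

Import Order.TTheory GRing.Theory Num.Theory.
Import numFieldNormedType.Exports.

Local Open Scope classical_set_scope.
Local Open Scope ring_scope.
Local Open Scope card_scope.

(** * Rosenthal's dichotomy *)

Lemma mkseqS_cons (T : Type) (f : nat -> T) k :
  mkseq f k.+1 = f 0%N :: mkseq (f \o succn) k.
Proof. by rewrite /mkseq -add1n iotaD /= (iotaDl 1%N 0%N) -map_comp. Qed.

Section Bars.
Variables (U : set_system nat) (Q : seq nat -> Prop).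

(** Well-founded trees of words, branching over members of [U], whose leaves violate [Q]. They live
    in [Type] so that [follow] can compute with them. *)
Inductive barred : seq nat -> Type :=
| barred_leaf s : ~ Q s -> barred s
| barred_node s (S : set nat) :
    U S -> (forall n, S n -> barred (rcons s n)) -> barred s.

(** The letters that keep the word [t] inside the tree [d]. Once [t] has left the tree or reached a
    leaf nothing is forbidden, so that the value lies in [U] for every [t]. *)
Fixpoint follow s (d : barred s) (t : seq nat) : set nat :=
  match d with
  | barred_leaf _ _ => setT
  | barred_node _ V _ next =>
    if t is n :: t' then
      if pselect (V n) is left Sn then follow (next n Sn) t' else setT
    else V
  end.

Lemma follow_mem s (d : barred s) t : Filter U -> U (follow d t).
Proof.
move=> FU; elim: d t => [{}s nQs|{}s V VU next IH] [|n t] //=;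
  try exact: filterT.
case: pselect => [Sn|_]; [exact: IH|exact: filterT].
Qed.

(** A sequence that takes only permitted letters descends in a well-founded tree, so it arrives at a
    leaf, where [Q] fails. *)
Lemma follow_bar s (d : barred s) (m : nat -> nat) :
  (forall k, follow d (mkseq m k) (m k)) -> exists k, ~ Q (s ++ mkseq m k).
Proof.
elim: d m => [{}s nQs|{}s V VU next IH] m dm; first by exists 0; rewrite cats0.
have Sm0 : V (m 0) := dm 0.
have [k|k nQ] := IH _ Sm0 (m \o succn).
  have := dm k.+1; rewrite mkseqS_cons /=.
  by case: pselect => // h; rewrite (Prop_irrelevance h Sm0).
by exists k.+1; rewrite mkseqS_cons -cat_rcons.
Qed.

(** If [U]-almost every one-letter extension were barred, the trees there would assemble into a tree
    at [s]. As [U] is an ultrafilter, almost every extension is therefore unbarred. *)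
Lemma not_barred s : UltraFilter U -> ~ inhabited (barred s) ->
  Q s /\ U [set n | ~ inhabited (barred (rcons s n))].
Proof.
move=> UU nb; split.
  by apply: contrapT => nQ; apply: nb; constructor; exact: barred_leaf.
have [Ub|//] :=
  in_ultra_setVsetC [set n | inhabited (barred (rcons s n))] UU.
exfalso; apply: nb; constructor; apply: (barred_node Ub) => n /= bn.
have {}bn : exists _ : barred (rcons s n), True by case: bn => d; exists d.
by case: (cid bn).
Qed.

End Bars.

Lemma increasing_inj (u : nat -> nat) :
  {homo u : m n / (m < n)%N} -> injective u.
Proof.
move=> uinc m n; apply: contra_eq; rewrite !neq_ltn.
by move=> /orP[] /uinc ->; rewrite ?orbT.
Qed.

Lemma subseq_rconsP (T : eqType) (t s : seq T) x : subseq t (rcons s x) ->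
  subseq t s \/ exists2 t', t = rcons t' x & subseq t' s.
Proof.
case/lastP: t => [|t y]; first by left; exact: sub0seq.
rewrite -(subseq_rev _ (rcons s x)) !rev_rcons /=.
case: eqP => [->|_]; last by rewrite -rev_rcons subseq_rev; left.
by rewrite subseq_rev; right; exists t.
Qed.

Lemma filter_subseq (F : set_system nat) (R : seq nat -> set nat) s :
  Filter F -> (forall t, F (R t)) ->
  F [set n | forall t, subseq t s -> R t n].
Proof.
move=> FF; elim/last_ind: s R => [|s x IH] R FR.
  by apply: filterS (FR [::]) => n Rn t; rewrite subseq0 => /eqP ->.
apply: filterS (filterI (IH R FR)
  (IH (fun t => R (rcons t x)) (fun t => FR _))).
move=> n [R1 R2] t /subseq_rconsP[|[t' ->]]; [exact: R1|exact: R2].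
Qed.

(** At stage [k] only finitely many pairs [(j, t)] impose a condition, so their intersection is
    still in [F]. That [F] contains [\oo] lets the next term exceed all earlier ones. *)
Lemma diagonal_sequence (F : set_system nat) (R : nat -> seq nat -> set nat) :
  ProperFilter F -> \oo `<=` F -> (forall j t, F (R j t)) ->
  exists u : nat -> nat, {homo u : m n / (m < n)%N} /\
    forall k j t, (j <= k)%N -> subseq t (mkseq u k) -> R j t (u k).
Proof.
move=> PF ooF FR.
have step s : exists n, [/\ forall m, m \in s -> (m < n)%N &
    forall j t, (j <= size s)%N -> subseq t s -> R j t n].
  have FR' : F [set n | forall j, (j <= size s)%N ->
      forall t, subseq t s -> R j t n].
    elim: (size s) => [|k IH].
      apply: filterS (filter_subseq s _ (FR 0)) => n Rn j.
      by rewrite leqn0 => /eqP ->.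
    apply: filterS (filterI IH (filter_subseq s _ (FR k.+1))) => n [R1 R2] j.
    by rewrite leq_eqVlt => /predU1P[->//|]; rewrite ltnS; exact: R1.
  have Fs : F [set n | forall m, m \in s -> (m < n)%N].
    apply: ooF; exists (\max_(m <- s) m).+1 => // n /= lt_s m ms.
    apply: leq_trans lt_s; rewrite ltnS.
    exact: (@leq_bigmax_seq _ s xpredT (fun m => m) m ms).
  have [n [n1 n2]] := filter_ex (filterI Fs FR').
  by exists n; split => // j t js ts; apply: n2.
have [v vP] := choice step.
pose fix L k := if k is k'.+1 then rcons (L k') (v (L k')) else [::].
exists (fun k => v (L k)).
have LE k : mkseq (fun k => v (L k)) k = L k.
  by elim: k => //= k IH; rewrite mkseqS IH.
have sL k : size (L k) = k by rewrite -LE size_mkseq.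
split=> [m n lt_mn|k j t jk].
  have [vL _] := vP (L n); apply: vL; rewrite -[in L n]LE.
  by apply/mapP; exists m; rewrite ?mem_iota.
by rewrite LE => tL; have [_ vL] := vP (L k); apply: vL; rewrite // sL.
Qed.

(* Farahat's argument, with an ultrafilter in place of Ramsey's theorem: Q j s
   says that A j (s 0), B j (s 1), A j (s 2), ... have a common point.  If the
   empty word is not barred, the sequence can be chosen so that none of its
   subsequences is; otherwise it can be chosen to follow the bars, so that no
   point oscillates along it. *)
Lemma rosenthal_dichotomy (T : Type) (A B : nat -> nat -> set T) :
  (exists j (u : nat -> nat), {homo u : m n / (m < n)%N} /\
    forall (phi : nat -> bool) k, exists z, forall i, (i < k)%N ->
      if phi i then A j (u i) z else B j (u i) z) \/
  (exists2 u : nat -> nat, {homo u : m n / (m < n)%N} & forall j z,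
    ~ ((forall N, exists2 n, (N <= n)%N & A j (u n) z) /\
       (forall N, exists2 n, (N <= n)%N & B j (u n) z))).
Proof.
have [U [UU ooU]] := @ultraFilterLemma nat \oo _.
pose Q j s := exists z, forall i, (i < size s)%N ->
  (if odd i then B j else A j) (nth 0 s i) z.
have [[j nb]|bar] := pselect (exists j, ~ inhabited (barred U (Q j) [::])).
- left; exists j.
  (* Terms chosen in [R] keep every subsequence of the chosen word unbarred, and [Q j] holds at
     unbarred words. *)
  pose R (_ : nat) t := [set n | ~ inhabited (barred U (Q j) t) ->
     ~ inhabited (barred U (Q j) (rcons t n))].
  have UR i t : U (R i t).
    have [b|b] := pselect (inhabited (barred U (Q j) t)).
      by apply: filterS filterT => n _ /= /(_ b).
    by have [_] := not_barred UU b; apply: filterS => n nbn _.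
  have [u [uinc uR]] := diagonal_sequence _ ooU UR.
  have nbu k t : subseq t (mkseq u k) -> ~ inhabited (barred U (Q j) t).
    elim: k t => [|k IH] t.
      by rewrite subseq0 => /eqP ->.
    rewrite mkseqS => /subseq_rconsP[|].
      exact: IH.
    move=> [t' -> t'k]; apply: (uR k 0) => //; exact: IH t'k.
  exists (fun i => u i.*2.+1); split=> [m n mn|phi k].
    by apply: uinc; rewrite ltnS ltn_double.
  (* u (2i) is used as a filler fixing the parity of the position of u (2i+1) *)
  have [s [sk sP]] : exists s, subseq s (mkseq u k.*2) /\
      forall i, (i < k)%N -> exists2 p, (p < size s)%N &
        nth 0 s p = u i.*2.+1 /\ odd p = ~~ phi i.
    elim: k => [|k [s [sk sP]]]; first by exists [::].
    have E : mkseq u k.+1.*2 = mkseq u k.*2 ++ [:: u k.*2; u k.*2.+1].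
      by rewrite doubleS !mkseqS -!cats1 -catA.
    pose f := if odd (size s) == ~~ phi k then [::] else [:: u k.*2].
    exists (s ++ rcons f (u k.*2.+1)); split.
      rewrite E cat_subseq// /f; case: ifP => _ /=; last by rewrite !eqxx.
      by case: eqP => //; rewrite eqxx.
    move=> i; rewrite ltnS leq_eqVlt => /predU1P[->|/sP[p ps [pE po]]].
      exists (size s + size f)%N.
        by rewrite size_cat size_rcons ltn_add2l.
      rewrite nth_cat ltnNge leq_addr/= addKn nth_rcons ltnn eqxx; split=> //.
      rewrite /f oddD; case: ifP => [/eqP ->|/=]; first by rewrite addbF.
      by case: (odd _); case: (phi k).
    exists p; first by rewrite size_cat (leq_trans ps)// leq_addr.
    by rewrite nth_cat ps.
  have [[z zs] _] := not_barred UU (nbu _ _ sk).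
  exists z => i ik; have [p ps [pE po]] := sP _ ik.
  by have := zs p ps; rewrite pE po; case: (phi i).
- right.
  have {}bar j : exists _ : barred U (Q j) [::], True.
    suff [d] : inhabited (barred U (Q j) [::]) by exists d.
    by apply: contrapT => nb; apply: bar; exists j.
  pose d j := sval (cid (bar j)).
  have [u [uinc uR]] := diagonal_sequence _ ooU
    (fun j t => follow_mem (d j) t _).
  exists u => // j z [infA infB].
  have next (b : bool) N : exists n, (N <= n)%N /\
      (if b then B j else A j) (u n) z.
    by case: b; [have [n] := infB N|have [n] := infA N]; exists n.
  have [nx nxP] := choice (fun bN => next bN.1 bN.2).
  (* [v] lists positions at which [z] lies alternately in the A-sets and the B-sets. It starts at
     [j] or later because the conditions of index [j] bind [u] only from stage [j] on. *)
  pose fix v k := if k is k'.+1 then nx (odd k, (v k').+1) else nx (false, j).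
  have vinc k : (v k < v k.+1)%N by have [] := nxP (odd k.+1, (v k).+1).
  have jv k : (j <= v k)%N.
    elim: k => [|k IH]; first by have [] := nxP (false, j).
    exact: leq_trans IH (ltnW (vinc k)).
  have subv k : subseq (mkseq (u \o v) k) (mkseq u (v k)).
    elim: k => [|k IH]; first exact: sub0seq.
    have -> : v k.+1 = (v k + (v k.+1 - v k).-1.+1)%N.
      by have := vinc k; lia.
    rewrite /mkseq iotaD -addn1 iotaD !map_cat cat_subseq//=.
    by rewrite !add0n/= eqxx sub0seq.
  have [k nQ] := follow_bar (fun k => uR _ _ _ (jv k) (subv k)).
  apply: nQ; exists z => i; rewrite size_mkseq => ik.
  rewrite nth_mkseq//=; case: i ik => [|i] _.
    by have [] := nxP (false, j).
  by have [] := nxP (odd i.+1, (v i).+1).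
Qed.

(** * Counting without independence *)

Section IndependenceTree.
Variables (R : realType) (T : Type) (h : nat -> T -> R).
Implicit Types (A : set nat) (p : T -> R) (a b : rat) (K : set T).

Local Notation word := (seq (nat * rat * bool)).

Definition side (w : nat * rat * bool) : set T :=
  [set z | if w.2 then ratr w.1.2 < h w.1.1 z else h w.1.1 z < ratr w.1.2].

(** A base of the coarsest topology making all [h i] continuous. Words form a countable type, so
    there are countably many cylinders. *)
Definition cylinder (l : word) : set T :=
  [set z | forall w, w \in l -> side w z].

Lemma cylinder_cons w l : cylinder (w :: l) = side w `&` cylinder l.
Proof.
apply/seteqP; split=> [z wl|z [wz lz] v].
  by split=> [|v vl]; apply: wl; rewrite in_cons ?eqxx ?vl ?orbT.
by rewrite in_cons => /predU1P[->|/lz].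
Qed.

(** What pointwise approximation of [p] by functions [h i] leaves at the two levels: strict
    inequalities persist on finite sets. *)
Definition level_approx A p a b := forall D : set T, finite_set D ->
  exists2 i, A i & forall z, D z ->
    (p z < ratr a -> h i z < ratr a) /\ (ratr b < p z -> ratr b < h i z).

Definition independent_levels a b (u : nat -> nat) :=
  forall (phi : nat -> bool) k, exists z, forall i, (i < k)%N ->
    if phi i then ratr b < h (u i) z else h (u i) z < ratr a.

(** Both level sets of [p] are dense in [K]. Stage [k] keeps a finite list of cylinders meeting [K],
    one per pattern of length [k]. Picking in each a point of either level set and an [h i]
    approximating [p] at all of them splits every cylinder in two. *)
Lemma independence_tree A p a b K : level_approx A p a b -> K !=set0 ->
  (forall l, cylinder l `&` K !=set0 ->
    cylinder l `&` K `&` [set z | p z < ratr a] !=set0 /\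
    cylinder l `&` K `&` [set z | ratr b < p z] !=set0) ->
  exists2 u, forall k, A (u k) & independent_levels a b u.
Proof.
move=> pA [z0 Kz0] dense.
pose ok (L : seq word) := forall l, l \in L -> cylinder l `&` K !=set0.
pose branch (i : nat) (c : bool) := (i, if c then b else a, c).
pose next (L : seq word) i :=
  [seq branch i false :: l | l <- L] ++ [seq branch i true :: l | l <- L].
have step L : exists i, ok L -> A i /\ ok (next L i).
  have [okL|] := pselect (ok L); last by exists 0%N.
  have pts l : exists xy : T * T, l \in L ->
      (cylinder l `&` K `&` [set z | p z < ratr a]) xy.1 /\
      (cylinder l `&` K `&` [set z | ratr b < p z]) xy.2.
    have [lL|lL] := boolP (l \in L); last by exists (z0, z0).
    by have [[x xP] [y yP]] := dense l (okL l lL); exists (x, y).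
  have [x xP] := choice pts.
  have [|i Ai iP] := pA ((fun l => (x l).1) @` [set` L] `|`
                         (fun l => (x l).2) @` [set` L]).
    by rewrite finite_setU; split; exact: finite_image.
  exists i => _; split=> // l; rewrite mem_cat.
  case/orP => /mapP[m mL ->]; have [[[cx Kx] px] [[cy Ky] py]] := xP m mL.
    exists (x m).1; split=> //; rewrite cylinder_cons; split=> //=.
    by apply: (iP _ _).1 => //; left; exists m.
  exists (x m).2; split=> //; rewrite cylinder_cons; split=> //=.
  by apply: (iP _ _).2 => //; right; exists m.
have [nx nxP] := choice step.
pose fix L k := if k is k'.+1 then next (L k') (nx (L k')) else [:: [::]].
have okL k : ok (L k).
  elim: k => [|k IH]; first by move=> l; rewrite inE => /eqP ->; exists z0.
  by have [] := nxP _ IH.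
exists (fun k => nx (L k)) => [k|phi k]; first by have [] := nxP _ (okL k).
suff [l lL lP] : exists2 l, l \in L k & forall z, cylinder l z ->
    forall i, (i < k)%N -> side (branch (nx (L i)) (phi i)) z.
  have [z [lz _]] := okL k l lL; exists z => i ik.
  by have := lP z lz i ik; rewrite /side/=; case: (phi i).
elim: k => [|k [l lL lP]]; first by exists [::]; rewrite ?inE.
exists (branch (nx (L k)) (phi k) :: l).
  by rewrite mem_cat; apply/orP; case: (phi k); [right|left]; apply: map_f.
move=> z; rewrite cylinder_cons => -[wz lz] i.
by rewrite ltnS leq_eqVlt => /predU1P[->//|]; exact: lP.
Qed.

(** Each piece is a difference of two open sets. The code [c] amounts to a subset of a countable
    type, so there are at most continuum many such unions. *)
Definition locally_closed_union (c : nat -> bool -> set word) : set T :=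
  \bigcup_k ((\bigcup_(l in c k true) cylinder l) `\`
             (\bigcup_(l in c k false) cylinder l)).

(* Either the level sets of p are separated by a countable union of locally
   closed sets, or they are both dense in some nonempty closed set. *)
Lemma level_separation A p a b : level_approx A p a b ->
  ~ (exists2 u, forall k, A (u k) & independent_levels a b u) ->
  exists c, [set z | ratr b < p z] `<=` locally_closed_union c /\
    locally_closed_union c `<=` [set z | ratr a <= p z].
Proof.
move=> pA nind.
pose good (O : set T) c := [set z | ratr b < p z] `&` O `<=`
  locally_closed_union c /\ locally_closed_union c `<=` [set z | ratr a <= p z].
pose N l := exists c, good (cylinder l) c.
have /choice[cN cNP] : forall l, exists c, N l -> good (cylinder l) c.
  move=> l; have [[c lc]|nl] := pselect (N l); first by exists c.
  by exists (fun _ _ => set0).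
(* [O] is the open set on which separation succeeds locally. Words being countable, the local
   separating families merge into a single one. *)
pose O := \bigcup_(l in N) cylinder l.
have [c [cp pc]] : exists c, good O c.
  exists (fun k => if unpickle k is Some (l, m) then
            if `[< N l >] then cN l m else fun=> set0 else fun=> set0).
  split=> z.
    move=> [pz [l Nl lz]]; have [/(_ z (conj pz lz))[m _ mz] _] := cNP l Nl.
    by exists (pickle (l, m)) => //; rewrite pickleK; case: asboolP.
  move=> [k _]; case: unpickle => [[l m]|]; last by move=> [[]].
  case: asboolP => [Nl|_ [[]]//] mz.
  by have [_] := cNP l Nl; apply; exists m.
have [OT|/existsNP[z0 Oz0]] := pselect (forall z, O z).
  by exists c; split=> // z pz; apply: cp; split.
exfalso; apply: nind.
apply: (@independence_tree A p a b (~` O)) => //; first by exists z0.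
move=> l [x [lx nOx]]; split; apply: contrapT => nl; apply: nOx; exists l => //.
  (* If [p] is never below [a] on [cylinder l] outside [O], that locally closed set can be added as
     a new piece, so separation succeeds on [cylinder l] and [l] was already in [N]. *)
  pose cl m := if m is k.+1 then c k else
    fun side => if side then [set l] else N.
  exists cl; split=> z.
    move=> [pz lz]; have [Oz|nOz] := pselect (O z).
      by have [k _ kz] := cp z (conj pz Oz); exists k.+1.
    by exists 0%N => //=; rewrite bigcup_set1.
  move=> [[_ /=|k _ kz]]; last by apply: pc; exists k.
  rewrite bigcup_set1 => -[lz nOz]; rewrite leNgt; apply/negP => pz.
  by apply: nl; exists z.
exists c; split=> // z [pz lz]; apply: cp; split=> //.
by apply: contrapT => nOz; apply: nl; exists z.
Qed.

End IndependenceTree.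

Lemma countable_powerset_card_le (T : Type) (D : countType) (E : set T)
    (code : T -> set D) :
  {in E &, injective code} -> E #<= [set: nat -> bool].
Proof.
move=> inj; apply/pcard_injP.
exists (fun t n => if unpickle n is Some d then `[< code t d >] else false).
move=> x y xE yE /funeqP xy; apply: inj => //; apply/seteqP.
by split=> d cd; have := xy (pickle d); rewrite pickleK;
  [rewrite (asboolT cd) => /esym/asboolP|rewrite (asboolT cd) => /asboolP].
Qed.

(** An element [p] is coded by the sets separating the levels of all [F i \o p] at all rational
    pairs. If [F i (q x) < F i (p x)], two rationals in between give levels at which [p] and [q]
    cannot share a separating set. *)
Lemma no_independence_card_le (R : realType) (T : Type) (E : set (T -> T))
    (F : nat -> T -> R) (h : nat -> T -> R) (A : nat -> set nat) :
  (forall x y, (forall i, F i x = F i y) -> x = y) ->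
  (forall p i a b, E p -> level_approx h (A i) (F i \o p) a b) ->
  (forall i a b, a < b ->
     ~ exists2 u, forall k, A i (u k) & independent_levels h a b u) ->
  E #<= [set: nat -> bool].
Proof.
move=> sep approx nind.
have codeE p : exists c : nat * rat * rat -> nat -> bool -> set _,
    forall i a b, E p -> a < b ->
      [set z | ratr b < F i (p z)] `<=` locally_closed_union h (c (i, a, b)) /\
      locally_closed_union h (c (i, a, b)) `<=` [set z | ratr a <= F i (p z)].
  suff : forall t : nat * rat * rat, exists c, E p -> t.1.2 < t.2 ->
      [set z | ratr t.2 < F t.1.1 (p z)] `<=` locally_closed_union h c /\
      locally_closed_union h c `<=` [set z | ratr t.1.2 <= F t.1.1 (p z)].
    by move=> /choice[c cP]; exists c => i a b Ep ab; exact: cP (i, a, b) Ep ab.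
  move=> [[i a] b] /=; have [Ep|nEp] := pselect (E p); last first.
    by exists (fun _ _ => set0).
  have [ab|nab] := boolP (a < b); last by exists (fun _ _ => set0).
  have [c cP] := level_separation (approx p i a b Ep) (nind i a b ab).
  by exists c.
have [c cP] := choice codeE.
pose code p : set (nat * rat * rat * nat * bool * seq (nat * rat * bool)) :=
  [set d | c p d.1.1.1 d.1.1.2 d.1.2 d.2].
apply: (@countable_powerset_card_le _ _ _ code).
move=> p q /set_mem Ep /set_mem Eq pq.
have {pq} cpq : c p = c q.
  apply/funext => t; apply/funext => k; apply/funext => s; apply/seteqP.
  by split=> w cw; have /seteqP[pq1 pq2] := pq;
    [exact: (pq1 (t, k, s, w))|exact: (pq2 (t, k, s, w))].
have le p' q' : E p' -> E q' -> c p' = c q' ->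
    forall i x, F i (p' x) <= F i (q' x).
  move=> Ep' Eq' cE i x; rewrite leNgt; apply/negP => lt_qp.
  have [a] := rat_in_itvoo lt_qp; rewrite in_itv/= => /andP[qa ap].
  have [b] := rat_in_itvoo ap; rewrite in_itv/= => /andP[ab bp].
  have ltab : a < b by rewrite -(ltr_rat R).
  have [cp' _] := cP p' i a b Ep' ltab; have [_ cq'] := cP q' i a b Eq' ltab.
  have := cp' x bp; rewrite cE => /cq' /=.
  by rewrite leNgt qa.
apply/funext => x; apply: sep => i; apply/eqP; rewrite eq_le.
by rewrite !le.
Qed.

(** * Large Ellis semigroups *)

Lemma compact_ultra_lim (T : topologicalType) (K : set T) (I : Type)
    (U : set_system I) (f : I -> T) :
  compact K -> UltraFilter U -> (forall i, K (f i)) ->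
  exists l : T, f @ U --> l.
Proof.
move=> cK UU Kf; have [l [_ fUl]] : K `&` cluster (f @ U) !=set0.
  by apply: cK; apply: (@filterS _ U _ setT) filterT => i _; exact: Kf.
exists l => V lV; have [//|UnV] := in_ultra_setVsetC (f @^-1` V) UU.
by have [x []] := fUl (~` V) V UnV lV.
Qed.

Lemma ptws_cvg (T : Type) (V : topologicalType) (F : set_system (T -> V))
    (f : {ptws T -> V}) :
  Filter F -> (forall t, (fun g => g t) @ F --> f t) -> F --> f.
Proof.
move=> FF Ff; apply/cvg_sup => i; apply/cvg_image.
  by rewrite eqEsubset; split=> // v _; exists (cst v).
by move=> W /(Ff i) fW; exists (@^~ i @^-1` W) => //; rewrite image_preimage//;
  rewrite eqEsubset; split=> // v _; exists (cst v).
Qed.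


(** The tail filter of the directed set of finite subsets of [I], with lists standing for finite
    sets. *)
Definition containing (I : eqType) : set_system (seq I) :=
  filter_from setT (fun l0 : seq I => [set l : seq I | {subset l0 <= l}]).

Lemma containing_proper (I : eqType) : ProperFilter (@containing I).
Proof.
apply: filter_from_proper; last by move=> l _; exists l.
apply: filter_from_filter; first by exists [::].
by move=> l m _ _; exists (l ++ m) => // s lms; split=> x xl; apply: lms;
  rewrite mem_cat xl ?orbT.
Qed.

Lemma containing_mem (I : eqType) (i : I) :
  containing [set l : seq I | i \in l].
Proof. by exists [:: i] => // l; apply; rewrite inE. Qed.

Lemma infinite_injection (T : Type) (A : set T) : infinite_set A ->
  exists2 e : nat -> T, forall n, A (e n) & injective e.
Proof.
move=> /infiniteP/card_leP[f].
exists (fun n => \val (f (SigSub (mem_setT n)))) => [n|m n /val_inj].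
  exact: set_valP.
by move=> /(inj (in_setT _) (in_setT _)) [].
Qed.

Section InfiniteIndependence.
Variables (G : groupType) (Z : topologicalType) (a : homeo_action G Z).
Hypothesis cZ : compact [set: Z].

(** Independence realizes the pattern on finite parts of [J]. An ultrafilter limit of the resulting
    points realizes it on all of [J], because the sets [A i] are closed. *)
Lemma independence_point k (A : 'I_k -> set Z) (J : set G) (phi : G -> 'I_k) :
  (forall i, closed (A i)) -> infinite_set J -> independence_set a A J ->
  exists z, forall s, J s -> A (phi s) (a s z).
Proof.
move=> clA infJ indJ.
have J0 : J !=set0.
  by apply/set0P; apply: contra_not_neq infJ => ->; exact: finite_set0.
have [z0 _] : exists z : Z, True.
  have [s0 Js0] := J0.
  have [|_ ->//|z _] := indJ _ (finite_set1 s0) _ _ phi; first by exists s0.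
  by exists z.
have zl (l : seq G) : exists z, forall s, s \in l -> J s -> A (phi s) (a s z).
  have [l0|l0] := pselect (J `&` [set` l] !=set0); last first.
    by exists z0 => s sl Js; exfalso; apply: l0; exists s.
  have [||z zP] := indJ (J `&` [set` l]) _ l0 _ phi.
  - exact: finite_setIr.
  - exact: subIsetl.
  by exists z => s sl Js; exact: zP.
have [z zP] := choice zl.
have [U [UU cU]] := ultraFilterLemma (containing_proper G).
have [x zx] := compact_ultra_lim cZ UU (fun l => I : [set: Z] (z l)).
exists x => s Js.
apply: (@closed_cvg _ Z U _ (a s \o z) (A (phi s)) (clA (phi s)) _ (a s x)).
  by apply: filterS (cU _ (containing_mem s)) => l sl; exact: zP.
apply: (cvg_comp _ _ zx); exact: action_continuous.
Qed.

Lemma separating_length (l : seq (nat -> bool)) : exists n,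
  forall x y, x \in l -> y \in l -> mkseq x n = mkseq y n -> x = y.
Proof.
have E (x y : nat -> bool) : exists m, forall n, (m <= n)%N ->
    mkseq x n = mkseq y n -> x = y.
  have [->|/eqP xy] := eqVneq x y; first by exists 0%N.
  have [m xym] : exists m, x m <> y m.
    by apply: contrapT => /forallNP xym; apply: xy; apply/funext => m;
      apply: contrapT; exact: xym.
  exists m.+1 => n mn /(congr1 (fun s => nth false s m)).
  by rewrite !nth_mkseq// => /xym.
have [m mP] := choice (fun xy => E xy.1 xy.2).
exists (\max_(x <- l) \max_(y <- l) m (x, y)) => x y xl yl.
apply: (mP (x, y)).
apply: leq_trans (@leq_bigmax_seq _ l xpredT
  (fun x => \max_(y <- l) m (x, y)) x xl isT).
exact: (@leq_bigmax_seq _ l xpredT (fun y => m (x, y)) y yl isT).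
Qed.

Lemma ellis_ultra_lim I (U : set_system I) (g : I -> G) (p : Z -> Z) :
  UltraFilter U -> (forall z, (fun i => a (g i) z) @ U --> p z) ->
  ellis_semigroup a p.
Proof.
move=> UU gp; pose q i : {ptws Z -> Z} := a (g i).
have qp : q @ U --> (p : {ptws Z -> Z}) by apply: ptws_cvg => z; exact: gp.
move=> W /qp UW; have [i Wi] : exists i, W (q i) by exact: (filter_ex (F := U)).
by exists (q i); split=> //; exists (g i).
Qed.

(* The sets [set d | mem x d], for x in the Cantor space, form an independent
   family.  Along a filter on finite lists of x's, v (d S l) eventually lies in
   the x-th set exactly when S x, so every S gives a different limit. *)
Lemma infinite_independence_not_tame (A : 'I_2 -> set Z) (J : set G) :
  (forall i, closed (A i)) -> A ord0 `&` A ord_max = set0 ->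
  infinite_set J -> independence_set a A J -> ~ tame a.
Proof.
move=> clA A01 infJ indJ.
have [e eJ einj] := infinite_injection infJ.
pose D := (nat * seq (seq bool))%type.
pose v (d : D) := e (pickle d).
have vinj : injective v by move=> c d /einj /(pcan_inj pickleK).
pose mem (x : nat -> bool) (d : D) := mkseq x d.1 \in d.2.
pose sgn b : 'I_2 := if b then ord_max else ord0.
(* Each [x] is represented by a point whose itinerary under the elements [v d] records [mem x d]. *)
have zx x : exists z, forall d, A (sgn (mem x d)) (a (v d) z).
  have [z zP] := independence_point
    (fun s => sgn `[< exists2 d, v d = s & mem x d >]) clA infJ indJ.
  exists z => d; have := zP (v d) (eJ _).
  suff -> : `[< exists2 c, v c = v d & mem x c >] = mem x d by [].
  by apply/asboolP/idP => [[c /vinj ->]|]; last exists d.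
have [z zP] := choice zx.
have [n nP] := choice separating_length.
have [U [UU cU]] := ultraFilterLemma (containing_proper (nat -> bool)).
pose d (S : set (nat -> bool)) l : D :=
  (n l, [seq mkseq x (n l) | x <- l & `[< S x >]]).
have dP S l x : x \in l -> mem x (d S l) = `[< S x >].
  move=> xl; apply/mapP/idP => [[y]|Sx]; last first.
    by exists x; rewrite ?mem_filter ?Sx.
  by rewrite mem_filter => /andP[Sy yl] /(nP l x y xl yl) ->.
have lim S y : exists t : Z, (fun l => a (v (d S l)) y) @ U --> t.
  exact: compact_ultra_lim cZ UU _.
have [p pP] := choice (fun Sy => lim Sy.1 Sy.2).
have pE S : ellis_semigroup a (fun y => p (S, y)).
  apply: (ellis_ultra_lim UU (g := fun l => v (d S l))) => y.
  exact: (pP (S, y)).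
have pA S x : A (sgn `[< S x >]) (p (S, z x)).
  apply: (@closed_cvg _ Z U _ _ (A (sgn `[< S x >])) (clA _) _ _ (pP (S, z x))).
  by apply: filterS (cU _ (containing_mem x)) => l xl; rewrite -(dP S l x xl).
rewrite /tame => /pcard_injP[f finj].
pose c S := f (fun y => p (S, y)).
have cinj S1 S2 : c S1 = c S2 -> S1 = S2.
  move=> /finj E; have {}E : (fun y => p (S1, y)) = (fun y => p (S2, y)).
    by apply: E; rewrite inE; exact: pE.
  apply/funext => x; apply/propext.
  have := pA S2 x; rewrite -(congr1 (@^~ (z x)) E) /= => p2; have p1 := pA S1 x.
  move: p1 p2; case: asboolP => S1x; case: asboolP => S2x //= p1 p2; exfalso;
    suff : set0 (p (S1, z x)) by []; by rewrite -A01.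
(* Cantor's diagonal set: [c] would inject the subsets of the Cantor space into the Cantor space. *)
pose K := [set x | exists2 S, c S = x & ~ S x].
have nK : ~ K (c K) by move=> KcK; have [S /cinj SK] := KcK; rewrite SK.
by apply: (nK); exists K.
Qed.

End InfiniteIndependence.

(** * Compactness of the space of probability measures *)

Section ContentExtension.
Local Open Scope ereal_scope.
Variables (R : realType) (X : ptopologicalType) (m : set X -> R).
Hypotheses (hX : hausdorff_space X) (cX : compact [set: X]).
Hypothesis m0 : m set0 = 0%R.
Hypothesis mT : m setT = 1%R.
Hypothesis le_m : forall K L, closed K -> closed L -> K `<=` L ->
  (m K <= m L)%R.
Hypothesis mU : forall K L, closed K -> closed L ->
  (m (K `|` L) <= m K + m L)%R.
Hypothesis m_add : forall K L, closed K -> closed L -> K `&` L = set0 ->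
  (m K + m L <= m (K `|` L))%R.

(** The classical passage from a content to a Radon measure: regularize from inside on open sets,
    then from outside on all sets, and restrict the outer measure to its Caratheodory sets. *)
Definition inner_content (U : set X) : \bar R :=
  ereal_sup [set (m K)%:E | K in [set K | closed K /\ K `<=` U]].

Definition outer_content (A : set X) : \bar R :=
  ereal_inf [set inner_content U | U in [set U | open U /\ A `<=` U]].

Lemma inner_content_ge K U : closed K -> K `<=` U ->
  (m K)%:E <= inner_content U.
Proof. by move=> cK KU; apply: ereal_sup_ubound; exists K. Qed.

Lemma inner_content_ge0 U : 0 <= inner_content U.
Proof.
have -> : 0 = (m set0)%:E by rewrite m0.
by apply: inner_content_ge => //; exact: closed0.
Qed.

Lemma inner_content_le U c :
  (forall K, closed K -> K `<=` U -> (m K)%:E <= c) -> inner_content U <= c.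
Proof. by move=> mc; apply: ge_ereal_sup => _ [K [cK KU] <-]; exact: mc. Qed.

Lemma le_inner_content U V : U `<=` V -> inner_content U <= inner_content V.
Proof.
move=> UV; apply: inner_content_le => K cK KU.
by apply: inner_content_ge => //; exact: subset_trans UV.
Qed.

Lemma inner_content_le1 U : inner_content U <= 1.
Proof.
apply: inner_content_le => K cK _.
by rewrite lee_fin -mT le_m//; exact: closedT.
Qed.

(** For closed [K] inside the union, normality separates the disjoint closed sets [K \ V] and
    [K \ U] by open sets [P1] and [P2]. Then [K \ P2] lies in [U], [K \ P1] lies in [V], and
    together they cover [K]. *)
Lemma inner_contentU U V : open U -> open V ->
  inner_content (U `|` V) <= inner_content U + inner_content V.
Proof.
move=> oU oV; apply: inner_content_le => K cK KUV.
have cD W : open W -> closed (K `\` W).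
  by move=> oW; apply: closedI => //; exact: open_closedC.
have KUV0 : (K `\` V) `&` (K `\` U) = set0.
  by apply/seteqP; split=> // x [[Kx nVx] [_ nUx]]; have [] := KUV x Kx.
have [P1 [P2 [oP1 oP2 KP1 KP2 P12]]] : exists P1 P2 : set X,
    [/\ open P1, open P2, K `\` V `<=` P1, K `\` U `<=` P2 & P1 `&` P2 = set0].
  have nX := (@normal_openP R X).1 (compact_normal hX cX).
  exact: nX (cD _ oV) (cD _ oU) KUV0.
have -> : K = (K `\` P2) `|` (K `\` P1).
  apply/seteqP; split=> [x Kx|x [[]|[]]//].
  have [P1x|nP1x] := pselect (P1 x); last by right.
  by left; split=> // P2x; have : set0 x by rewrite -P12.
apply: (@le_trans _ _ ((m (K `\` P2))%:E + (m (K `\` P1))%:E)).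
  by rewrite -EFinD lee_fin; apply: mU; exact: cD.
apply: leeD; apply: inner_content_ge; try exact: cD.
  by move=> x [Kx nP2x]; apply: contrapT => nUx; apply: nP2x; exact: KP2.
by move=> x [Kx nP1x]; apply: contrapT => nVx; apply: nP1x; exact: KP1.
Qed.

Lemma inner_content_bigcup (U : nat -> set X) : (forall n, open (U n)) ->
  inner_content (\bigcup_n U n) <= \sum_(n <oo) inner_content (U n).
Proof.
move=> oU; apply: inner_content_le => K cK KU.
have : cover_compact K.
  by rewrite -compact_cover; exact: subclosed_compact cX _.
case/(_ nat setT U (fun n _ => oU n)) => [x /KU[n _ Unx]|D _ KD].
  by exists n.
pose n := (\max_(i <- finmap.enum_fset D) i).+1.
have KDn : K `<=` \big[setU/set0]_(i < n) U i.
  move=> x /KD[i Di Uix]; rewrite -bigcup_mkord; exists i => //=.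
  by rewrite /n ltnS; exact: (@leq_bigmax_seq _ _ xpredT id i Di).
apply: (@le_trans _ _ (\sum_(i < n) inner_content (U i))).
  apply: (le_trans (inner_content_ge cK KDn)) => {KDn}.
  elim: n => [|n IH]; first by rewrite !big_ord0; apply: inner_content_le =>
    L cL; rewrite subset0 => ->; rewrite m0.
  rewrite !big_ord_recr/=; apply: (le_trans (inner_contentU _ (oU n))).
    by rewrite -bigcup_mkord; apply: bigcup_open => i _; exact: oU.
  exact: leeD2r.
rewrite -(big_mkord xpredT (fun i => inner_content (U i))).
by apply: nneseries_lim_ge => i *; exact: inner_content_ge0.
Qed.

Lemma outer_content_open U : open U -> outer_content U = inner_content U.
Proof.
move=> oU; apply/eqP; rewrite eq_le; apply/andP; split.
  by apply: ereal_inf_lbound; exists U => //; split.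
by apply: le_ereal_inf_tmp => _ [V [oV UV] <-]; exact: le_inner_content.
Qed.

Lemma outer_content_le A U : open U -> A `<=` U ->
  outer_content A <= inner_content U.
Proof. by move=> oU AU; apply: ereal_inf_lbound; exists U. Qed.

Lemma outer_content_ge0 A : 0 <= outer_content A.
Proof. by apply: le_ereal_inf_tmp => _ [V _ <-]; exact: inner_content_ge0. Qed.

Lemma outer_content_fin A : outer_content A \is a fin_num.
Proof.
rewrite ge0_fin_numE ?outer_content_ge0//.
rewrite (@le_lt_trans _ _ (inner_content setT))//; last first.
  by rewrite (le_lt_trans (inner_content_le1 _))// ltry.
by apply: outer_content_le => //; exact: openT.
Qed.

Lemma outer_content0 : outer_content set0 = 0.
Proof.
rewrite (outer_content_open open0); apply/eqP.
rewrite eq_le inner_content_ge0 andbT; apply: inner_content_le => K _.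
by rewrite subset0 => ->; rewrite m0.
Qed.

Lemma le_outer_content : {homo outer_content : A B / A `<=` B >-> A <= B}.
Proof.
move=> A B AB; apply: le_ereal_inf_tmp => _ [V [oV BV] <-].
by apply: outer_content_le => //; exact: subset_trans BV.
Qed.

Lemma outer_content_sigma_subadditive : sigma_subadditive outer_content.
Proof.
move=> F; apply/lee_addgt0Pr => e e0.
have e2 n : (0 < e / (2 ^ n.+1)%:R)%R by rewrite divr_gt0// ltr0n expn_gt0.
have adh n := lb_ereal_inf_adherent (e2 n) (outer_content_fin (F n)).
have UP n : exists U, [/\ open U, F n `<=` U &
    inner_content U <= outer_content (F n) + (e / (2 ^ n.+1)%:R)%:E].
  by have [_ [U [oU FU] <-] /ltW] := adh n; exists U.
have [U UP'] := choice UP.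
apply: (@le_trans _ _ (inner_content (\bigcup_n U n))).
  apply: outer_content_le; first by apply: bigcup_open => i _; case: (UP' i).
  by apply: subset_bigcup => i _; case: (UP' i).
apply: (le_trans (inner_content_bigcup _)); first by move=> i; case: (UP' i).
apply: le_trans (epsilon_trick _ _ (ltW e0)); last first.
  by move=> n; exact: outer_content_ge0.
apply: lee_nneseries => [n _ _|n _]; first exact: inner_content_ge0.
by case: (UP' n).
Qed.

HB.instance Definition _ := isOuterMeasure.Build R X outer_content
  outer_content0 outer_content_ge0 le_outer_content
  outer_content_sigma_subadditive.

(** It suffices to split open [V] containing [A]. Exhaust [V & U] by closed [K] and then [V \ K],
    which contains [A \ U], by closed [L]; superadditivity applies to the disjoint sets [K] and
    [L]. *)
Lemma open_caratheodory U : open U -> outer_content.-caratheodory U.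
Proof.
move=> oU; apply: le_caratheodory_measurable => A.
apply: le_ereal_inf_tmp => _ [V [oV AV] <-].
have oVU : open (V `&` U) by exact: openI.
apply: (@le_trans _ _ (inner_content (V `&` U) + outer_content (A `&` ~` U))).
  by apply: leeD2r; apply: outer_content_le => //; exact: setSI.
rewrite -leeBrDr ?outer_content_fin//; apply: inner_content_le => K cK KVU.
rewrite leeBrDr ?outer_content_fin// addeC.
have oVK : open (V `\` K) by apply: openI => //; exact: closed_openC.
apply: (@le_trans _ _ (inner_content (V `\` K) + (m K)%:E)).
  apply: leeD2r; apply: outer_content_le => // x [Ax nUx].
  by split; [exact: AV|move=> /KVU[]].
rewrite -leeBrDr//; apply: inner_content_le => L cL LVK.
rewrite leeBrDr// -EFinD; apply: (@le_trans _ _ (m (L `|` K))%:E).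
  rewrite lee_fin; apply: m_add => //.
  by apply/seteqP; split=> // x [/LVK[_]].
apply: inner_content_ge; first exact: closedU.
by move=> x [/LVK[]//|/KVU[]].
Qed.

Lemma borel_caratheodory (A : set (borel X)) :
  measurable A -> outer_content.-caratheodory A.
Proof.
(* Borel measurability unfolds to membership in every sigma-algebra containing the open sets. *)
move=> mA; apply: (mA outer_content.-caratheodory); split=> [|B oB].
  split.
  - exact: caratheodory_measurable_set0.
  - by move=> B cB; rewrite setTD; exact: caratheodory_measurable_setC.
  - by move=> F cF; exact: caratheodory_measurable_bigcup.
exact: open_caratheodory.
Qed.

Lemma content_extension : exists nu : probability (borel X) R,
  forall U, open U -> nu U = inner_content U.
Proof.
pose mu : set (borel X) -> \bar R := outer_content.
have mu_sigma : semi_sigma_additive mu.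
  move=> F mF tF mUF.
  apply: (@caratheodory_measure_sigma_additive R X outer_content F _ tF).
    by move=> i; exact: borel_caratheodory.
  exact: borel_caratheodory.
pose mM := isMeasure.Build _ _ _ mu outer_content0 outer_content_ge0 mu_sigma.
pose muM : {measure set (borel X) -> \bar R} := HB.pack mu mM.
have muT : muM setT = 1.
  rewrite /muM/= /mu (outer_content_open openT).
  apply/eqP; rewrite eq_le inner_content_le1/=.
  by have := @inner_content_ge setT setT closedT (fun=> id); rewrite mT.
pose pM := Measure_isProbability.Build _ _ _ muM muT.
pose nu : probability (borel X) R := HB.pack mu mM pM.
exists nu => U oU; exact: outer_content_open.
Qed.

End ContentExtension.

(** * Integrals of bounded functions and layer sums *)

Lemma sum_indic_normr_le (R : realType) (T : Type) (A : nat -> set T) n x :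
  `|\sum_(i < n) \1_(A i) x| <= n%:R :> R.
Proof.
rewrite ger0_norm ?sumr_ge0//.
rewrite -[n in leRHS]card_ord -sum1_card natr_sum ler_sum// => i _.
by rewrite indicE; case: (_ \in _).
Qed.

Section BoundedIntegrals.
Context {R : realType} d {X : measurableType d} (P : probability X R).
Implicit Types f g : X -> R.

Lemma integrable_bounded f (C : R) : measurable_fun setT f ->
  (forall x, `|f x| <= C) -> P.-integrable setT (EFin \o f).
Proof.
move=> mf fC; apply: measurable_bounded_integrable => //.
  by rewrite (le_lt_trans (probability_le1 P _))// ltry.
exists C; split; first exact: num_real.
by move=> M CM x _ /=; rewrite (le_trans (fC x))// ltW.
Qed.

Lemma Rintegral_affine f (C c e : R) : measurable_fun setT f ->
  (forall x, `|f x| <= C) -> \int[P]_x (c * f x + e) = c * \int[P]_x f x + e.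
Proof.
move=> mf fC; have If := integrable_bounded mf fC.
rewrite RintegralD//; [|exact: (integrableZl measurableT c If)|].
- have P1 : fine (P setT) = 1 by rewrite probability_setT.
  by rewrite RintegralZl// Rintegral_cst// P1 mulr1.
- by apply: (@integrable_bounded (fun=> e) `|e|) => //; exact: measurable_cst.
Qed.

Lemma Rintegral_normr_le f (C : R) : measurable_fun setT f ->
  (forall x, `|f x| <= C) -> `|\int[P]_x f x| <= C.
Proof.
move=> mf fC; have If := integrable_bounded mf fC.
apply: (le_trans (le_normr_Rintegral measurableT If)).
have P1 : fine (P setT) = 1 by rewrite probability_setT.
rewrite -[leRHS]mulr1 -P1 -(Rintegral_cst P measurableT).
apply: le_Rintegral => //.
  apply: (@integrable_bounded (fun x => `|f x|) C) => [|x].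
    exact: measurableT_comp.
  by rewrite normr_id.
apply: (@integrable_bounded (fun=> C) `|C|) => //; exact: measurable_cst.
Qed.

Lemma Rintegral_sum_indic (A : nat -> set X) n :
  (forall i, measurable (A i)) ->
  \int[P]_x (\sum_(i < n) \1_(A i) x) = \sum_(i < n) fine (P (A i)).
Proof.
move=> mA; elim: n => [|n IH].
  rewrite big_ord0 -[RHS](mul0r (fine (P setT))) -Rintegral_cst//.
  by apply: eq_Rintegral => x _; rewrite big_ord0.
rewrite big_ord_recr/= -IH.
under eq_Rintegral do rewrite big_ord_recr/=.
rewrite RintegralD//.
- by congr (_ + _); rewrite /Rintegral integral_indic// setIT.
- apply: (@integrable_bounded (fun x => \sum_(i < n) \1_(A i) x) n%:R).
    by apply: measurable_sum => i; exact: measurable_indic.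
  exact: sum_indic_normr_le.
- exact: integrable_indic.
Qed.

End BoundedIntegrals.

(** The sum counts the naturals strictly below [y], so it is the ceiling of [y]. *)
Lemma layer_sum (R : realType) (y : R) n : 0 <= y <= n%:R ->
  \sum_(i < n) ((i%:R < y)%R%:R : R) - 1 <= y <= \sum_(i < n) (i%:R < y)%R%:R.
Proof.
elim: n y => [|n IH] y.
  by rewrite big_ord0 => /andP[y0 y1]; apply/andP; split; lra.
move=> /andP[y0 yn]; rewrite big_ord_recl/=.
have -> : \sum_(i < n) ((lift ord0 i)%:R < y)%R%:R =
    \sum_(i < n) (i%:R < y - 1)%R%:R :> R.
  by apply: eq_bigr => i _; rewrite lift0 -natr1 ltrBrDr.
have [y1|y1] := ltP 1 y.
  have : 0 <= y - 1 <= n%:R.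
    by rewrite subr_ge0 (ltW y1)/= lerBlDr -(natrD _ n 1) addn1.
  move=> /IH; rewrite (lt_trans ltr01 y1) /= => /andP[h1 h2].
  by rewrite -addrA -lerBrDl h1 -lerBlDl h2.
have -> : \sum_(i < n) (i%:R < y - 1)%R%:R = 0 :> R.
  by apply: big1 => i _; rewrite ltNge (le_trans _ (ler0n _ _))// subr_le0.
move: y0; rewrite le_eqVlt => /predU1P[<-|y0].
  by rewrite ltxx addr0 lexx subr_le0 ler01.
by rewrite y0 addr0 subrr y1 ltW.
Qed.

Lemma cvg_sum_ord (R : realType) (T : Type) (F : set_system T) n
    (u : nat -> T -> R) (l : nat -> R) :
  Filter F -> (forall i, u i x @[x --> F] --> l i) ->
  \sum_(i < n) u i x @[x --> F] --> \sum_(i < n) l i.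
Proof.
move=> FF ul; elim: n => [|n IH].
  by rewrite big_ord0; under eq_fun do rewrite big_ord0; exact: cvg_cst.
rewrite big_ord_recr/=; under eq_fun do rewrite big_ord_recr/=.
exact: cvgD IH (ul n).
Qed.

(** * Weak-star compactness *)

Section WeakStarCompact.
Variables (R : realType) (X : ptopologicalType).
Hypotheses (hX : hausdorff_space X) (cX : compact [set: X]).
Local Notation M := (prob_measure R X).

Lemma continuous_bounded (f : X -> R) : continuous f ->
  exists2 C : R, 0 < C & forall x, `|f x| <= C.
Proof.
move=> cf; have : compact (f @` setT).
  by apply: continuous_compact => //; exact: continuous_subspaceT.
move=> /compact_bounded[C [_ CP]]; exists (`|C| + 1); first by rewrite ltr_wpDl.
by move=> x; apply: CP; [rewrite ltr_pwDr// ler_norm|exists x].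
Qed.

Lemma prob_measure_cvg (I : Type) (F : set_system I) (u : I -> M) (mu : M) :
  Filter F ->
  (forall f : continuousType X R,
    \int[u i]_x f x @[i --> F] --> \int[mu]_x f x) ->
  u @ F --> mu.
Proof.
move=> FF uf; apply/cvg_sup => f A [_ [[B oB <-] Bmu BA]].
have nB : nbhs (\int[mu]_x f x) B by exact: open_nbhs_nbhs.
by apply: (@filterS _ F _ [set i | B (\int[u i]_x f x)]) (uf f B nB) => i /BA.
Qed.

Let bounds01 (mu : M) (A : set X) : 0 <= fine (mu A) <= 1.
Proof.
have [mA|nA] := pselect (measurable (A : set (borel X))); last first.
  by rewrite prob_measure_out//= lexx ler01.
rewrite fine_ge0//= -lee_fin fineK ?probability_le1//.
exact: fin_num_measure.
Qed.

(** [m A] is the limit of the masses of [A] along the ultrafilter. It is finitely additive on Borel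
    sets, and [nu] is the measure built from its values on closed sets. Convergence of integrals to
    those of [nu] is proved as two inequalities. *)
Lemma prob_measure_compact : compact [set: M].
Proof.
rewrite compact_ultra => U UU _.
have /choice[m mP] : forall A : set X, exists l : R,
    fine ((mu : M) A) @[mu --> U] --> l.
  move=> A; have A01 (mu : M) : `[0, 1]%classic (fine (mu A)).
    by rewrite /= in_itv/=; exact: bounds01.
  exact: compact_ultra_lim (@segment_compact R 0 1) UU A01.
have open_meas (V : set X) : open V -> measurable (V : set (borel X)).
  by move=> oV; exact: sub_sigma_algebra.
have closed_meas (K : set X) : closed K -> measurable (K : set (borel X)).
  move=> cK; rewrite -[K]setCK; apply: measurableC; apply: open_meas.
  exact: closed_openC.
have le_m (A B : set X) : measurable (A : set (borel X)) ->
    measurable (B : set (borel X)) -> A `<=` B -> m A <= m B.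
  move=> mA mB AB; apply: ler_cvg_to (mP A) (mP B) _.
  by apply: nearW => mu; rewrite fine_le ?fin_num_measure// le_measure// inE.
have [nu nuP] : exists nu : probability (borel X) R,
    forall V, open V -> nu V = inner_content m V.
  apply: content_extension => //.
  - apply: (cvg_unique (@Rhausdorff R) (mP set0)).
    rewrite (_ : (fun mu : M => _) = cst 0); first exact: cvg_cst.
    by apply/funext => mu; rewrite measure0.
  - apply: (cvg_unique (@Rhausdorff R) (mP setT)).
    rewrite (_ : (fun mu : M => _) = cst 1); first exact: cvg_cst.
    by apply/funext => mu; rewrite probability_setT.
  - by move=> K L cK cL KL; apply: le_m => //; exact: closed_meas.
  - move=> K L /closed_meas mK /closed_meas mL.
    apply: ler_cvg_to (mP _) (cvgD (mP K) (mP L)) _; apply: nearW => mu.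
    rewrite -lee_fin EFinD !fineK ?fin_num_measure//; last exact: measurableU.
    exact: measureU2.
  - move=> K L /closed_meas mK /closed_meas mL KL0.
    apply: ler_cvg_to (cvgD (mP K) (mP L)) (mP _) _; apply: nearW => mu.
    rewrite -lee_fin EFinD !fineK ?fin_num_measure//; last exact: measurableU.
    by rewrite measureU.
(* Only this inequality can be expected, as mass may drift to the boundary of [V]. It bounds
   integrals from above through open superlevel sets. *)
have nu_open V : open V -> fine (nu V) <= m V.
  move=> oV; rewrite -lee_fin fineK ?fin_num_measure//; last exact: open_meas.
  rewrite nuP//; apply: inner_content_le => K cK KV.
  by rewrite lee_fin; apply: le_m => //; [exact: closed_meas|exact: open_meas].
exists (prob_measure_of nu); split=> //.
apply: (@prob_measure_cvg _ U id) => f.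
have [C C0 fC] := continuous_bounded (@cts_fun _ _ f).
have half (g : X -> R) l : continuous g -> (forall x, `|g x| <= C) ->
    \int[mu : M]_x g x @[mu --> U] --> l -> \int[prob_measure_of nu]_x g x <= l.
  move=> cg gC gl.
  have mg := measurable_continuous cg.
  (* layer cake with n levels: 2C/n times the sum of the measures of the
     superlevel sets A i approximates the integral of g + C up to 2C/n *)
  have key (n : nat) : (0 < n)%N ->
      \int[prob_measure_of nu]_x g x <= l + 2 * C / n%:R.
    move=> n0; have n0' : 0 < n%:R :> R by rewrite ltr0n.
    pose A (i : nat) := [set x | i%:R < n%:R / (2 * C) * (g x + C)].
    have oA i : open (A i).
      apply: (@open_comp _ _ (fun x => n%:R / (2 * C) * (g x + C))
        [set y | i%:R < y]).
        move=> x _; apply: cvgM; first exact: cvg_cst.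
        by apply: cvgD; [exact: cg|exact: cvg_cst].
      exact: open_gt.
    have mA i := open_meas _ (oA i).
    have bnd x : n%:R * g x <= 2 * C * (\sum_(i < n) \1_(A i) x) - n%:R * C /\
        2 * C * (\sum_(i < n) \1_(A i) x - 1) - n%:R * C <= n%:R * g x.
      pose y := n%:R / (2 * C) * (g x + C).
      have yE : 2 * C * y = n%:R * g x + n%:R * C.
        by rewrite /y; field; rewrite gt_eqF.
      have /layer_sum : 0 <= y <= n%:R.
        have := fC x; have := gC x; rewrite ler_norml => /andP[g1 g2] _.
        rewrite /y mulr_ge0 ?divr_ge0//=; [|lra|lra].
        by rewrite -mulrA ler_piMr// mulrC ler_pdivrMr; lra.
      have -> : \sum_(i < n) (i%:R < y)%R%:R = \sum_(i < n) \1_(A i) x :> R.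
        by apply: eq_bigr => i _; rewrite indicE; congr (_ : bool)%:R;
          apply/idP/idP; rewrite inE.
      move=> /andP[y1 y2]; have C2 : 0 < 2 * C by rewrite mulr_gt0.
      by split; [have := ler_wpM2l (ltW C2) y2|have := ler_wpM2l (ltW C2) y1];
        rewrite yE; lra.
    have Ib (P : probability (borel X) R) : n%:R * \int[P]_x g x <=
        2 * C * (\sum_(i < n) fine (P (A i))) - n%:R * C /\
        2 * C * (\sum_(i < n) fine (P (A i)) - 1) - n%:R * C <=
          n%:R * \int[P]_x g x.
      pose h x : R := \sum_(i < n) \1_(A i) x.
      have mh : measurable_fun [set: borel X] (h : borel X -> R).
        by apply: measurable_sum => i; exact: measurable_indic.
      have hn x : `|h x| <= n%:R by exact: sum_indic_normr_le.
      have affine_int (k : X -> R) D c e :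
          measurable_fun [set: borel X] (k : borel X -> R) ->
          (forall x, `|k x| <= D) ->
          P.-integrable [set: borel X] (EFin \o (fun x => c * k x + e)).
        move=> mk kD; apply: (@integrable_bounded _ _ _ P _ (`|c| * D + `|e|)).
          apply: measurable_funD; last exact: measurable_cst.
          by apply: measurable_funM => //; exact: measurable_cst.
        move=> x; rewrite (le_trans (ler_normD _ _))// lerD2r normrM.
        by rewrite ler_wpM2l.
      have intg : n%:R * \int[P]_x g x = \int[P]_x (n%:R * g x + 0).
        by rewrite (Rintegral_affine P n%:R 0 mg gC) addr0.
      have inth e : 2 * C * (\sum_(i < n) fine (P (A i))) + e =
          \int[P]_x (2 * C * h x + e).
        by rewrite (Rintegral_affine P (2 * C) e mh hn) Rintegral_sum_indic.
      split.
        rewrite intg inth; apply: le_Rintegral => //.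
        - exact: affine_int mg gC.
        - exact: affine_int mh hn.
        - by move=> x _; have [+ _] := bnd x; rewrite addr0.
      rewrite mulrBr mulr1 -addrA intg inth; apply: le_Rintegral => //.
      - exact: affine_int mh hn.
      - exact: affine_int mg gC.
      - by move=> x _; have [_] := bnd x; rewrite addr0 mulrBr mulr1 -addrA.
    have nuE : \sum_(i < n) fine (prob_measure_of nu (A i)) <=
        \sum_(i < n) m (A i).
      by apply: ler_sum => i _; rewrite prob_measure_ofE//; exact: nu_open.
    have [up _] := Ib (prob_measure_of nu).
    have low : 2 * C * (\sum_(i < n) m (A i) - 1) - n%:R * C <= n%:R * l.
      apply: (@ler_cvg_to M U _ R
        (fun mu : M => 2 * C * (\sum_(i < n) fine (mu (A i)) - 1) - n%:R * C)
        (fun mu : M => n%:R * \int[mu]_x g x) _ (n%:R * l)).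
      - apply: cvgB; last exact: cvg_cst.
        apply: cvgM; first exact: cvg_cst.
        apply: cvgB; last exact: cvg_cst.
        exact: (@cvg_sum_ord R M U n (fun i (mu : M) => fine (mu (A i)))
          (fun i => m (A i)) _ (fun i => mP (A i))).
      - by apply: cvgM; [exact: cvg_cst|exact: gl].
      - by apply: nearW => mu; have [_] := Ib mu.
    have CC : 2 * C * (\sum_(i < n) fine (prob_measure_of nu (A i))) <=
        2 * C * \sum_(i < n) m (A i) by rewrite ler_wpM2l// mulr_ge0// ltW.
    rewrite -(ler_pM2l n0') mulrDr mulrCA divff ?gt_eqF// mulr1.
    by rewrite (le_trans up)//; move: low CC; rewrite mulrBr; lra.
  (* With [n] above [2 * C / e], the layer error [2 * C / n] is below [e]. *)
  apply/ler_addgt0Pr => e e0; pose n := (Num.truncn (2 * C / e)).+1.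
  apply: (le_trans (key n isT)); rewrite lerD2l ler_pdivrMr ?ltr0n//.
  by rewrite -ler_pdivrMl// mulrC; exact/ltW/truncnS_gt.
have cf := @cts_fun _ _ f; have mf := measurable_continuous cf.
have fint (mu : M) : `[- C, C]%classic (\int[mu]_x f x).
  by rewrite /= in_itv/= -ler_norml; exact: Rintegral_normr_le.
have [l fl] := compact_ultra_lim (@segment_compact R (- C) C) UU fint.
suff -> : \int[prob_measure_of nu]_x f x = l by exact: fl.
apply/eqP; rewrite eq_le half//=.
have oppE (P : probability (borel X) R) :
    \int[P]_x (- f x) = - \int[P]_x f x.
  rewrite -mulN1r -[RHS]addr0 -(Rintegral_affine P (-1) 0 mf fC).
  by apply: eq_Rintegral => x _; rewrite mulN1r addr0.
(* The upper bound applied to [- f] is the missing lower bound for [f]. *)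
have := @half (fun x => - f x) (- l); rewrite oppE lerN2; apply.
- by move=> x; apply: cvgN; exact: cf.
- by move=> x; rewrite normrN.
- rewrite (_ : (fun mu : M => _) = (fun mu : M => - \int[mu]_x f x)).
    exact: cvgN.
  by apply/funext => mu; rewrite oppE.
Qed.

End WeakStarCompact.

(** * A countable family of functions separating measures *)

Lemma Rintegral_bounded_cvg (R : realType) d (T : measurableType d)
    (P : probability T R) (f_ : nat -> T -> R) (f : T -> R) (C : R) :
  (forall n, measurable_fun setT (f_ n)) -> (forall n x, `|f_ n x| <= C) ->
  (forall x, f_ n x @[n --> \oo] --> f x) ->
  \int[P]_x f_ n x @[n --> \oo] --> \int[P]_x f x.
Proof.
move=> mf fC ff.
have IC : P.-integrable setT (EFin \o cst C).
  by apply: (@integrable_bounded _ _ _ P (cst C) `|C|) => //;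
    exact: measurable_cst.
have ffE x : setT x -> (f_ n x)%:E @[n --> \oo] --> (f x)%:E.
  by move=> _; apply/fine_cvgP; split; [exact: nearW|exact: ff].
have mfE n : measurable_fun setT (EFin \o f_ n) by exact/measurable_EFinP.
have dom n x : setT x -> (`|(f_ n x)%:E| <= (EFin \o cst C) x)%E.
  by move=> _; rewrite /= lee_fin.
have If : P.-integrable setT (EFin \o f).
  apply: (@integrable_bounded _ _ _ P f C) => [|x].
    exact: (measurable_fun_cvg mf (fun x _ => ff x)).
  by apply: cvgr_to_le (cvg_norm (ff x)) _; exact: nearW.
have := @dominated_cvg _ _ _ P setT measurableT (fun n => EFin \o f_ n)
  (EFin \o f) (EFin \o cst C) mfE ffE (fun x _ => isT) IC dom.
rewrite -[X in _ --> X](@fineK _ (\int[P]_x (EFin \o f) x)%E); last first.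
  exact: integrable_fin_num.
by move=> /fine_cvgP[].
Qed.

Lemma metrizable_distance (R : realType) (X : topologicalType) :
  metrizable R X -> exists d : X -> X -> R, [/\ forall x, d x x = 0,
    forall x y, d x y = 0 -> x = y, forall x y, d x y = d y x,
    forall x y z, d x z <= d x y + d y z &
    forall x A, nbhs x A <-> exists2 e, 0 < e & forall y, d x y < e -> A y].
Proof.
move=> [m opE]; pose Y := Metric.Pack m; exists (@mdist R Y); split.
- exact: (@mdistxx R Y).
- exact: (@mdist_positivity R Y).
- exact: (@metric_sym R Y).
- exact: (@metric_triangle R Y).
have nE : @nbhs Y Y = @nbhs X X.
  apply/funext => x; apply/funext => A.
  by rewrite (@nbhsE Y) (@nbhsE X) /open_nbhs -/Y opE.
move=> x A; rewrite -[nbhs x A]/(@nbhs X X x A) -nE.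
split=> [/(@nbhs_ballP R Y)[e /= e0 xA]|[e e0 xA]].
  by exists e => // y xy; apply: xA; rewrite ballEmdist.
by apply/(@nbhs_ballP R Y); exists e => // y; rewrite ballEmdist; exact: xA.
Qed.

Section MetrizableCompact.
Variables (R : realType) (X : ptopologicalType).
Hypotheses (cX : compact [set: X]) (mX : metrizable R X).

Lemma metrizable_hausdorff : hausdorff_space X.
Proof.
have [d [d0 dE dS dT dN]] := metrizable_distance mX.
move=> x y xy; apply: contrapT => nxy.
have d_gt0 : 0 < d x y.
  rewrite lt_neqAle; apply/andP; split.
    by apply/eqP => /esym/dE.
  have := dT x y x; rewrite d0 (dS y x); lra.
have nb z : nbhs z [set w | d z w < d x y / 2].
  by apply/dN; exists (d x y / 2) => //; lra.
have [z [/= xz yz]] := xy _ _ (nb x) (nb y).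
by have := dT x z y; rewrite (dS z y); lra.
Qed.

Lemma distance_continuous (d : X -> X -> R) q : (forall x y, d x y = d y x) ->
  (forall x y z, d x z <= d x y + d y z) ->
  (forall x A, nbhs x A <-> exists2 e, 0 < e & forall y, d x y < e -> A y) ->
  continuous (d q).
Proof.
move=> dS dT dN x; apply/cvgrPdist_lt => e e0; apply/dN; exists e => // y xy.
rewrite ltr_norml; apply/andP; split.
  by have := dT q x y; lra.
by have := dT q y x; rewrite (dS y x); lra.
Qed.

(** Finite intersections [B l] of rational balls around a dense sequence form a countable pi-system
    generating the Borel sets. Their indicators are bounded limits of the continuous functions
    [h l k], so the integrals of the latter determine the measure. *)
Lemma separating_functions : exists f : nat -> X -> R,
  (forall n, continuous (f n)) /\
  forall mu nu : prob_measure R X,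
    (forall n, \int[mu]_x f n x = \int[nu]_x f n x) -> mu = nu.
Proof.
have [d [d0 dE dS dT dN]] := metrizable_distance mX.
have cd q : continuous (d q) by exact: distance_continuous.
have [q qP] : exists q : nat -> X, forall x e, 0 < e -> exists n, d (q n) x < e.
  have net n : exists D : seq X, forall x,
      exists2 p, p \in D & d p x < n.+1%:R^-1.
    have : cover_compact [set: X] by rewrite -compact_cover.
    case/(_ X setT (fun p => [set x | d p x < n.+1%:R^-1])).
    - by move=> p _; apply: (@open_comp _ _ (d p) [set y | y < _]);
        [move=> ? _; exact: cd|exact: open_lt].
    - by move=> x _; exists x => //=; rewrite d0 invr_gt0.
    - move=> D _ DP; exists (finmap.enum_fset D) => x.
      by have [p pD px] := DP x I; exists p.
  have [D DP] := choice net.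
  exists (fun k =>
    if unpickle k is Some (n, i) then nth point (D n) i else point).
  move=> x e e0; have [p pD px] := DP (Num.truncn e^-1) x.
  exists (pickle (Num.truncn e^-1, index p (D (Num.truncn e^-1)))).
  rewrite pickleK nth_index//; apply: (lt_trans px).
  by rewrite invf_plt ?posrE//; exact: truncnS_gt.
pose B (l : seq (nat * rat)) :=
  [set x | forall p, p \in l -> d (q p.1) x < ratr p.2].
(* As [k] grows, [ramp k] tends pointwise to the indicator of the positive reals. *)
pose ramp (k : nat) (y : R) := Num.min 1 (k%:R * Num.max 0 y).
pose h (l : seq (nat * rat)) (k : nat) x :=
  \prod_(p <- l) ramp k (ratr p.2 - d (q p.1) x).
have cramp k : continuous (ramp k).
  move=> y; apply: (@continuous_min R R (cst 1) (fun y => k%:R * Num.max 0 y)).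
    exact: cvg_cst.
  apply: cvgM; first exact: cvg_cst.
  by apply: (@continuous_max R R (cst 0) id); [exact: cvg_cst|exact: cvg_id].
have ch l k : continuous (h l k).
  elim: l => [|p l IH] x.
    rewrite /continuous_at /h; under eq_fun do rewrite big_nil.
    rewrite big_nil; exact: cvg_cst.
  rewrite /continuous_at /h; under eq_fun do rewrite big_cons.
  rewrite big_cons; apply: cvgM; last exact: IH.
  apply: (cvg_comp (fun y => ratr p.2 - d (q p.1) y) (ramp k)) (cramp k _).
  by apply: cvgB; [exact: cvg_cst|exact: cd].
have ramp01 k y : 0 <= ramp k y <= 1.
  by rewrite /ramp le_min ler01 ge_min lexx mulr_ge0// le_max lexx.
have h01 l k x : 0 <= h l k x <= 1.
  apply/andP; split; last by apply: prodr_ile1 => p _; exact: ramp01.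
  apply: prodr_ge0 => p _.
  by case/andP: (ramp01 k (ratr p.2 - d (q p.1) x)).
have ramp_cvg y : ramp k y @[k --> \oo] --> ((0 < y)%R%:R : R).
  have [y0|y0] := ltP 0 y; last first.
    rewrite (_ : (fun k => _) = cst 0); first exact: cvg_cst.
    by apply/funext => k; rewrite /ramp (max_l y0) mulr0 min_r.
  apply: cvg_near_cst; exists (Num.truncn y^-1).+1 => // k /= yk.
  rewrite /ramp max_r ?(ltW y0)// min_l// -ler_pdivrMr// mul1r.
  by rewrite (le_trans (ltW (truncnS_gt _)))// ler_nat.
have h_cvg l x : h l k x @[k --> \oo] --> (\1_(B l) x : R).
  elim: l => [|p l IH].
    rewrite /h; under eq_fun do rewrite big_nil.
    by rewrite indicE mem_set//; exact: cvg_cst.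
  rewrite /h; under eq_fun do rewrite big_cons.
  have -> : \1_(B (p :: l)) x =
      (0 < ratr p.2 - d (q p.1) x)%R%:R * \1_(B l) x :> R.
    rewrite !indicE subr_gt0 -natrM mulnb; congr (_ : bool)%:R.
    apply/idP/andP; rewrite !inE.
      by move=> Bx; split=> [|r rl]; apply: Bx; rewrite in_cons ?eqxx ?rl ?orbT.
    by move=> [px Bx] r; rewrite in_cons => /predU1P[->|/Bx].
  by apply: cvgM; [exact: ramp_cvg|exact: IH].
exists (fun n => if unpickle n is Some (l, k) then h l k else cst 0).
split=> [n|mu nu E].
  by case: unpickle => [[l k]|]; [exact: ch|move=> x; exact: cvg_cst].
have {}E l k : \int[mu]_x h l k x = \int[nu]_x h l k x.
  by have := E (pickle (l, k)); rewrite pickleK.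
have oB l : open (B l).
  elim: l => [|p l IH].
    by rewrite (_ : B _ = setT); [exact: openT|apply/seteqP].
  rewrite (_ : B _ = [set x | d (q p.1) x < ratr p.2] `&` B l).
    apply: openI => //; apply: (@open_comp _ _ (d _) [set y | y < _]).
      by move=> ? _; exact: cd.
    exact: open_lt.
  apply/seteqP; split=> [x Bx|x [px Bx] r].
    by split=> [|r rl]; apply: Bx; rewrite in_cons ?eqxx ?rl ?orbT.
  by rewrite in_cons => /predU1P[->|/Bx].
have mB l : measurable (B l : set (borel X)) by exact: sub_sigma_algebra.
have muB l : mu (B l) = nu (B l).
  have lim_int (P : probability (borel X) R) :
      \int[P]_x h l k x @[k --> \oo] --> fine (P (B l)).
    have -> : fine (P (B l)) = \int[P]_x (\1_(B l) x).
      by rewrite /Rintegral integral_indic// setIT.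
    apply: (@Rintegral_bounded_cvg _ _ _ P (fun k => h l k) _ 1) => // [k|k x].
      exact: measurable_continuous (@ch l k).
    by case/andP: (h01 l k x) => h0 h1; rewrite ger0_norm.
  have fE : fine (mu (B l)) = fine (nu (B l)).
    apply: (cvg_unique (@Rhausdorff R) (lim_int mu)).
    rewrite (_ : (fun k => _) = (fun k => \int[nu]_x h l k x)).
      exact: lim_int.
    by apply/funext => k; exact: E.
  by rewrite -[LHS]fineK ?fin_num_measure// fE fineK// fin_num_measure.
have sB : <<s range B>> = (measurable : set (set (borel X))).
  apply/seteqP; split.
    apply: smallest_sub; first exact: smallest_sigma_algebra.
    by move=> _ [l _ <-]; exact: mB.
  apply: smallest_sub; first exact: smallest_sigma_algebra.
  move=> U oU.
  have [dec decK] : exists dec : nat -> option (seq (nat * rat)),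
      forall l, dec (pickle l) = Some l by exists unpickle; exact: pickleK.
  have -> : U = \bigcup_n (if dec n is Some l then
      if `[< B l `<=` U >] then B l else set0 else set0).
    apply/seteqP; split=> [x Ux|x [n _]]; last first.
      by case: (dec n) => // l; case: asboolP => // BU /BU.
    have [e e0 eU] : exists2 e, 0 < e & forall y, d x y < e -> U y.
      by apply/dN; exact: open_nbhs_nbhs.
    (* A center within [e / 3] of [x] and a rational radius [r] between [e / 3] and [e / 2] give a
       ball containing [x] and of points at distance less than [e] from it. *)
    have e3 : 0 < e / 3 by rewrite divr_gt0.
    have [n nx] := qP x _ e3.
    have e32 : e / 3 < e / 2 by lra.
    have [r] := rat_in_itvoo e32; rewrite in_itv/= => /andP[r1 r2].
    have BU : B [:: (n, r)] `<=` U.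
      move=> y /(_ (n, r)); rewrite inE eqxx => /(_ isT)/= ny.
      by apply: eU; have := dT x (q n) y; rewrite (dS x (q n)); lra.
    exists (pickle [:: (n, r)]); first by [].
    rewrite decK asboolT//.
    by move=> p; rewrite inE => /eqP -> /=; exact: lt_trans nx r1.
  have [_ _ + ] := smallest_sigma_algebra setT (range B).
  apply=> n; case: (dec n) => [l|]; last exact: sigma_algebra0.
  case: asboolP => _; last exact: sigma_algebra0.
  by apply: sub_sigma_algebra; exists l.
apply: prob_measure_ext => A mA.
apply: (@measure_unique _ R (borel X) (range B) (fun=> setT) (esym sB)
  _ _ _ mu nu _ _ A mA).
- move=> _ _ [l _ <-] [l' _ <-]; exists (l ++ l') => //.
  apply/seteqP; split=> [x Bx|x [Bx Bx'] p].
    by split=> p pl; apply: Bx; rewrite mem_cat pl ?orbT.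
  by rewrite mem_cat => /orP[/Bx|/Bx'].
- by move=> _; exists [::] => //; apply/seteqP; split=> // x _ p.
- by apply/seteqP; split=> // x _; exists 0%N.
- by move=> _ [l _ <-]; exact: muB.
- by move=> _; rewrite (le_lt_trans (probability_le1 mu _))// ltry.
Qed.

End MetrizableCompact.

(** * Localization of independence *)

Section IndependentPairs.
Variables (G : groupType) (Z : topologicalType) (a : homeo_action G Z).
Implicit Types (A B : set Z) (g : nat -> G).

(** Independence along an enumeration: [phi] chooses a side for each term, and initial segments
    suffice. Infinitude enters separately, as injectivity in [indep_pair]. *)
Definition indep_seq A B g := forall (phi : nat -> bool) k, exists z,
  forall j, (j < k)%N -> if phi j then B (a (g j) z) else A (a (g j) z).

Definition indep_pair A B := exists2 g, injective g & indep_seq A B g.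

Definition set_pair A B : 'I_2 -> set Z := fun i => if i == ord0 then A else B.

Lemma set_pairE A B (b : bool) :
  set_pair A B (if b then ord_max else ord0) = if b then B else A.
Proof. by case: b. Qed.

Lemma closed_set_pair_levels (R : realType) (h : Z -> R) (r s : R) i :
  continuous h -> closed (set_pair [set z | h z <= r] [set z | s <= h z] i).
Proof.
move=> ch; rewrite /set_pair; case: ifP => _.
  apply: (@closed_comp _ _ h [set y | y <= r]) => [? _|]; first exact: ch.
  exact: closed_le.
apply: (@closed_comp _ _ h [set y | s <= y]) => [? _|]; first exact: ch.
exact: closed_ge.
Qed.

(** Choosing opposite sides at two positions with equal terms would put one point into both sets. *)
Lemma indep_seq_inj A B g : A `&` B = set0 -> indep_seq A B g -> injective g.
Proof.
move=> AB0 indg; suff lt_inj j k : (j < k)%N -> g j <> g k.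
  by move=> j k gjk; case: (ltngtP j k) => // /lt_inj; rewrite gjk.
move=> jk gjk; have [z zP] := indg (fun i => i == k) k.+1.
have := zP k (ltnSn k); have := zP j (ltn_trans jk (ltnSn k)).
rewrite eqxx (ltn_eqF jk) gjk => Az Bz.
by have : set0 (a (g k) z) by rewrite -AB0.
Qed.

Lemma indep_pair_sym A B : indep_pair A B -> indep_pair B A.
Proof.
move=> [g injg indg]; exists g => // phi k.
have [z zP] := indg (negb \o phi) k; exists z => j /zP /=.
by case: (phi j).
Qed.

Lemma indep_pair_subset A A' B B' : A `<=` A' -> B `<=` B' ->
  indep_pair A B -> indep_pair A' B'.
Proof.
move=> AA' BB' [g injg indg]; exists g => // phi k.
have [z zP] := indg phi k; exists z => j /zP.
by case: (phi j); [exact: BB'|exact: AA'].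
Qed.

Lemma indep_seq_set A B g : injective g -> indep_seq A B g ->
  infinite_set (range g) /\ independence_set a (set_pair A B) (range g).
Proof.
move=> injg indg; split.
  move=> /(finite_preimage (in2W injg)).
  by rewrite preimage_range; exact: infinite_nat.
move=> I finI _ Ig phi.
have [k kP] : exists k, forall s, I s -> exists2 j, (j < k)%N & g j = s.
  have /choice[j jP] : forall s, exists j, I s -> g j = s.
    by move=> s; have [/Ig[j _ <-]|] := pselect (I s); [exists j|exists 0%N].
  have /finite_seqP[l lE] := finite_image j finI.
  exists (\max_(i <- l) i).+1%N => s Is; exists (j s); last exact: jP.
  rewrite ltnS; apply: (@leq_bigmax_seq _ l xpredT id) => //.
  have js : (j @` I) (j s) by exists s.
  by move: js; rewrite lE.
have [z zP] := indg (fun j => phi (g j) != ord0) k.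
exists z => s Is /=; have [j jk <-] := kP s Is.
by have := zP j jk; rewrite /set_pair; case: eqP.
Qed.

(* Sequences of points of Z, with U-almost sure membership, stand for limit
   points, so that A, A' and B need not be closed. *)
Lemma indep_pair_split A A' B : indep_pair (A `|` A') B ->
  indep_pair A B \/ indep_pair A' B.
Proof.
move=> [g injg indg].
have [U [UU ooU]] := @ultraFilterLemma nat \oo _.
pose C (j : nat) := if j is 0%N then A else A'.
have [[j [u [uinc ind]]]|[u uinc conv]] := @rosenthal_dichotomy (nat -> Z)
  (fun j n => [set t | U [set m | C j (a (g n) (t m))]])
  (fun j n => [set t | U [set m | B (a (g n) (t m))]]).
- have : indep_pair (C j) B.
    exists (g \o u) => [|phi k].
      exact: inj_comp (increasing_inj uinc).
    have [t tP] := ind (negb \o phi) k.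
    have [m mP] : exists m, forall i : 'I_k,
        (if phi i then B else C j) (a (g (u i)) (t m)).
      apply: (@filter_ex _ U _); apply: filter_forall => i.
      by have := tP i (ltn_ord i); rewrite /=; case: (phi i).
    by exists (t m) => i ik; have := mP (Ordinal ik); rewrite /=; case: (phi i).
  by case: j {ind} => [|j]; [left|right].
- exfalso.
  have uinj := increasing_inj uinc.
  (* The sequence [t] lies almost surely in [B] at odd positions of [u] and in the union at even
     ones. The ultrafilter decides for [A] or [A'] at each even position, and one of them occurs
     infinitely often, so [t] oscillates. *)
  have [t tP] := choice (indg (fun m => `[< exists2 n, u n = m & odd n >])).
  have tU n : U [set m | if odd n then B (a (g (u n)) (t m)) else
                          (A `|` A') (a (g (u n)) (t m))].
    apply: ooU; exists (u n).+1 => // m /= un; have := tP m (u n) un.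
    have -> : `[< exists2 i, u i = u n & odd i >] = odd n.
      by apply/asboolP/idP => [[i /uinj ->]|]; last exists n.
    by [].
  have infB N : exists2 n, (N <= n)%N & U [set m | B (a (g (u n)) (t m))].
    exists N.*2.+1; first by rewrite -addnn leqW// leq_addr.
    by have := tU N.*2.+1; rewrite /= odd_double.
  have [infA|/existsNP[N NA]] := pselect
      (forall N, exists2 n, (N <= n)%N & U [set m | A (a (g (u n)) (t m))]).
    by apply: (conv 0%N t); split.
  apply: (conv 1%N t); split=> // M; exists (N + M).*2.
    by rewrite -addnn; lia.
  have UAA : U ([set m | A (a (g (u (N + M).*2)) (t m))] `|`
                [set m | A' (a (g (u (N + M).*2)) (t m))]).
    by have := tU (N + M).*2; rewrite odd_double.
  have [UA|UnA] :=
    in_ultra_setVsetC [set m | A (a (g (u (N + M).*2)) (t m))] UU.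
    by exfalso; apply: NA; exists (N + M).*2 => //; rewrite -addnn; lia.
  apply: (@filterS _ U _ _ _ _ (filterI UAA UnA)) => m [[//|//] nA]; exact: nA.
Qed.

(** Cutting [A] and then [B] along the last rectangle yields three pairs by [indep_pair_split]. One
    lies in that rectangle, and the other two avoid it and are covered by the earlier ones. *)
Lemma indep_pair_cover (W : nat -> set Z * set Z) n A B :
  (forall i, (i < n)%N -> ~ indep_pair (W i).1 (W i).2) ->
  (forall x y, A x -> B y -> exists2 i, (i < n)%N & (W i).1 x /\ (W i).2 y) ->
  ~ indep_pair A B.
Proof.
elim: n A B => [|n IH] A B nW cov.
  move=> [g _ indg]; have [z zP] := indg (fun j => j == 1%N) 2.
  by have [] := cov _ _ (zP 0%N isT) (zP 1%N isT).
have {}IH A' B' : (forall x y, A' x -> B' y -> A x /\ B y) ->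
    (forall x y, A' x -> B' y -> ~ ((W n).1 x /\ (W n).2 y)) ->
    ~ indep_pair A' B'.
  move=> AB nWn; apply: IH => [i im|x y A'x B'y]; first exact/nW/ltnW.
  have [Ax By] := AB x y A'x B'y.
  have [i] := cov x y Ax By.
  rewrite ltnS leq_eqVlt => /predU1P[->|ilt] Wxy; last by exists i.
  by have := nWn x y A'x B'y.
have AE : A = (A `&` (W n).1) `|` (A `\` (W n).1) by rewrite setUIDK.
have BE : B = (B `&` (W n).2) `|` (B `\` (W n).2) by rewrite setUIDK.
rewrite {1}AE => /indep_pair_split[|]; last first.
  by apply: IH => [x y [Ax _] By|x y [_ nW1] _ []].
move=> /indep_pair_sym; rewrite {1}BE => /indep_pair_split[|] /indep_pair_sym.
  move=> /(indep_pair_subset (@subIsetr _ _ _) (@subIsetr _ _ _)).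
  exact: nW.
by apply: IH => [x y [Ax _] [By _]|x y _ [_ nW2] []].
Qed.

End IndependentPairs.

(** Otherwise every point of the compact product has a neighborhood rectangle without independence,
    and finitely many of these cover it, against [indep_pair_cover]. *)
Lemma indep_points (G : groupType) (X : ptopologicalType)
    (a : homeo_action G X) (A B : set X) :
  compact A -> compact B -> indep_pair a A B ->
  exists x y, [/\ A x, B y &
    forall U V, nbhs x U -> nbhs y V -> indep_pair a U V].
Proof.
move=> cA cB indAB; apply: contrapT => nxy.
have bad (p : X * X) : exists W : set X * set X, ~ indep_pair a W.1 W.2 /\
    ((A `*` B) p -> nbhs p (W.1 `*` W.2)).
  have [[Ap Bp]|] := pselect ((A `*` B) p); last first.
    exists (set0, set0); split=> // -[g _ indg].
    by have [z zP] := indg xpredT 1%N; have := zP 0%N isT.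
  apply: contrapT => nW; apply: nxy; exists p.1, p.2; split=> // U V Up Vp.
  apply: contrapT => nUV; apply: nW; exists (U, V); split=> // _.
  by exists (U, V).
have [W WP] := choice bad.
have /compact_near_coveringP ncov := compact_setX cA cB.
pose P (l : seq (X * X)) p := exists2 q, q \in l & ((W q).1 `*` (W q).2) p.
have [l _ /(_ l (fun _ => id)) cov] :
    \forall l \near @containing _, A `*` B `<=` P l.
  apply: ncov => [|p ABp]; first exact: containing_proper.
  have [_ /(_ ABp) Wp] := WP p.
  exists ((W p).1 `*` (W p).2, [set l : seq (X * X) | p \in l]) => /=.
    by split=> //; exact: containing_mem.
  by move=> [x l] [/= Wx pl]; exists p.
apply: (@indep_pair_cover _ _ a (fun i => W (nth point l i)) (size l) A B
  _ _ indAB).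
  by move=> i _; case: (WP (nth point l i)).
move=> x y Ax By; have [p pl [W1 W2]] := cov (x, y) (conj Ax By).
by exists (index p l); rewrite ?index_mem ?nth_index.
Qed.

(** * Independence from failure of tameness *)

Lemma countable_enum (G : groupType) : countable [set: G] ->
  exists e : nat -> G, forall g, exists n, e n = g.
Proof.
move=> /pcard_injP[f finj].
have /choice[e eP] : forall n, exists g', forall g, f g = n -> g' = g.
  move=> n; have [[g fg]|ng] := pselect (exists g, f g = n).
    by exists g => g'; rewrite -fg => /finj; rewrite !inE => /(_ I I).
  by exists 1%g => g fg; exfalso; apply: ng; exists g.
by exists e => g; exists (f g); exact: eP.
Qed.

Lemma ptws_finite_nbhs (T : eqType) (V : topologicalType) (p : {ptws T -> V})
    (D : set T) (W : T -> set V) : finite_set D ->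
  (forall t, D t -> nbhs (p t) (W t)) ->
  nbhs p [set q : {ptws T -> V} | forall t, D t -> W t (q t)].
Proof.
move=> /finite_seqP[s ->]; elim: s => [|t s IH] pW.
  by apply: filterS filterT => q _ t.
have Wt : nbhs p [set q : {ptws T -> V} | W t (q t)].
  have := @proj_continuous T (fun=> V) t p; apply.
  by apply: pW; rewrite /= inE eqxx.
have Ws : nbhs p [set q : {ptws T -> V} | forall t', t' \in s -> W t' (q t')].
  by apply: IH => t' ts; apply: pW; rewrite /= inE ts orbT.
apply: filterS (filterI Wt Ws) => q [Wtq Wsq] t'.
by rewrite /= inE => /predU1P[->//|]; exact: Wsq.
Qed.

Section NotTameIndependence.
Variables (R : realType) (G : groupType) (Z : topologicalType).
Variables (a : homeo_action G Z) (F : nat -> Z -> R).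
Hypothesis cF : forall i, continuous (F i).
Hypothesis sepF : forall x y, (forall i, F i x = F i y) -> x = y.
Hypothesis cG : countable [set: G].

(** The sequence [h] lists all translates of all [F i]. An element of the Ellis semigroup is a
    pointwise limit of translations, which gives [level_approx] among translates of the same [F i],
    so the counting bound applies. *)
Lemma not_tame_indep : ~ tame a -> exists i (r s : rat),
  r < s /\
  exists g, indep_seq a [set z | F i z < ratr r] [set z | ratr s < F i z] g.
Proof.
move=> nta; apply: contrapT => nind; apply: nta.
have [e eP] := countable_enum cG.
have [dec decP] : exists dec : nat -> nat * nat, forall m, exists j, dec j = m.
  exists (fun j => odflt (0, 0)%N (unpickle j)) => m.
  by exists (pickle m); rewrite pickleK.
pose h j z := F (dec j).1 (a (e (dec j).2) z).
apply: (@no_independence_card_le R Z (ellis_semigroup a) F h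
  (fun i => [set j | (dec j).1 = i])) =>
    // [p i r s Ep D finD|i r s rs [u uA ind]].
  pose W t := [set z | (F i (p t) < ratr r -> F i z < ratr r) /\
                       (ratr s < F i (p t) -> ratr s < F i z)].
  have pW t : D t -> nbhs (p t) (W t).
    move=> _.
    have Wr : nbhs (p t) [set z | F i (p t) < ratr r -> F i z < ratr r].
      have [lt_r|_] := boolP (F i (p t) < ratr r); last exact: nearW.
      by apply: filterS (cvgr_lt _ (@cF i (p t)) _ lt_r) => z /= Fz _.
    have Ws : nbhs (p t) [set z | ratr s < F i (p t) -> ratr s < F i z].
      have [gt_s|_] := boolP (ratr s < F i (p t)); last exact: nearW.
      by apply: filterS (cvgr_gt _ (@cF i (p t)) _ gt_s) => z /= Fz _.
    exact: filterI Wr Ws.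
  have [_ [[g _ <-] gW]] := Ep _ (ptws_finite_nbhs finD pW).
  have [n en] := eP g; have [j jE] := decP (i, n).
  by exists j => [|z /gW]; rewrite /= ?/h jE//= en.
apply: nind; exists i, r, s; split=> //.
exists (fun k => e (dec (u k)).2) => phi k; have [z zP] := ind phi k.
by exists z => j /zP; rewrite /h /= (uA j); case: (phi j).
Qed.

End NotTameIndependence.

(** An ultrafilter limit [l] is approached infinitely often. Without convergence the sequence is
    also infinitely often at distance at least [e] on one side of [l], and two rationals in between
    witness an oscillation. *)
Lemma oscillation_cvg (R : realType) (c : nat -> R) (C : R) :
  (forall n, `|c n| <= C) ->
  (forall p q : rat, p < q ->
     ~ ((forall N, exists2 n, (N <= n)%N & c n < ratr p) /\
        (forall N, exists2 n, (N <= n)%N & ratr q < c n))) ->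
  exists l : R, c n @[n --> \oo] --> l.
Proof.
move=> cC osc; have [U [UU ooU]] := @ultraFilterLemma nat \oo _.
have cI n : `[- C, C]%classic (c n) by rewrite /= in_itv/= -ler_norml.
have [l cl] := compact_ultra_lim (@segment_compact R (- C) C) UU cI.
have freq (A : set R) : nbhs l A -> forall N, exists2 n, (N <= n)%N & A (c n).
  move=> lA N; have UA : U [set n | A (c n)] := cl _ lA.
  have UN : U [set n | (N <= n)%N] by apply: ooU; exists N.
  by have [n [nN An]] := filter_ex (filterI UN UA); exists n.
exists l; apply/cvgrPdist_lt => e e0; apply: contrapT => nnear.
have inf N : exists2 n, (N <= n)%N & e <= `|l - c n|.
  apply: contrapT => nN; apply: nnear; exists N => // n /= Nn.
  by rewrite ltNge; apply/negP => en; apply: nN; exists n.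
have le1 : l - e < l by rewrite gtrBl.
have le2 : l < l + e by rewrite ltrDl.
have [p1] := rat_in_itvoo le1; rewrite in_itv/= => /andP[lp1 pl1].
have [q1] := rat_in_itvoo pl1; rewrite in_itv/= => /andP[pq1 ql1].
have [q2] := rat_in_itvoo le2; rewrite in_itv/= => /andP[lq2 ql2].
have [p2] := rat_in_itvoo lq2; rewrite in_itv/= => /andP[lp2 pq2].
have [low|/existsNP[N0 nlow]] :=
  pselect (forall N, exists2 n, (N <= n)%N & c n < ratr p1).
  apply: (osc p1 q1); first by rewrite -(ltr_rat R).
  by split=> //; exact: (freq [set y | ratr q1 < y] (lt_nbhsr ql1)).
apply: (osc p2 q2); first by rewrite -(ltr_rat R).
split; first exact: (freq [set y | y < ratr p2] (lt_nbhsl lp2)).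
move=> N; have [n Nn] := inf (N0 + N)%N; rewrite ler_normr => /orP[le|le].
  exfalso; apply: nlow; exists n; first exact: leq_trans (leq_addr _ _) Nn.
  by apply: le_lt_trans lp1; lra.
exists n; first exact: leq_trans (leq_addl _ _) Nn.
by apply: lt_le_trans ql2 _; lra.
Qed.

(** * Descent of independence from measures to points *)

Section Measures.
Variables (R : realType) (G : groupType) (X : ptopologicalType).
Variable (a : homeo_action G X).
Hypotheses (cX : compact [set: X]) (mX : metrizable R X).
Local Notation M := (prob_measure R X).

(* Rosenthal's dichotomy turns a failure of independence on X into pointwise
   convergence, which dominated convergence transports to the integrals. *)
Lemma indep_integral (f : X -> R) (r s : R) (g : nat -> G) :
  continuous f -> r < s ->
  indep_seq (push_action R a) [set mu : M | \int[mu]_x f x < r]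
    [set mu : M | s < \int[mu]_x f x] g ->
  exists p q : rat, p < q /\
    indep_pair a [set x | f x < ratr p] [set x | ratr q < f x].
Proof.
move=> cf rs indg; pose F (mu : M) := \int[mu]_x f x.
have disj (T : Type) (h : T -> R) (p q : R) : p < q ->
    [set t | h t < p] `&` [set t | q < h t] = set0.
  move=> pq; apply/seteqP; split=> // t [/= tp qt].
  by have := lt_trans (lt_trans tp pq) qt; rewrite ltxx.
have ginj : injective g by apply: indep_seq_inj indg; exact: disj.
have cF : continuous F.
  exact: (@integral_continuous R X (mkcts cf)).
have [C _ fC] := continuous_bounded cX cf.
have [dec decP] : exists dec : nat -> rat * rat, forall t, exists j, dec j = t.
  exists (fun j => odflt (0, 0) (unpickle j)) => t.
  by exists (pickle t); rewrite pickleK.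
(* Including the order of the two rationals empties the sets of badly ordered pairs, so an
   independent [j] is automatically well ordered. *)
pose lowset j := [set x | (dec j).1 < (dec j).2 /\ f x < ratr (dec j).1].
pose highset j := [set x | (dec j).1 < (dec j).2 /\ ratr (dec j).2 < f x].
have [[j [u [uinc ind]]]|[u uinc conv]] := @rosenthal_dichotomy X
  (fun j n => a (g n) @^-1` lowset j) (fun j n => a (g n) @^-1` highset j).
  have jlt : (dec j).1 < (dec j).2.
    by have [z zP] := ind xpredT 1%N; have [] := zP 0%N isT.
  exists (dec j).1, (dec j).2; split=> //.
  have ind' : indep_seq a [set x | f x < ratr (dec j).1]
      [set x | ratr (dec j).2 < f x] (g \o u).
    move=> phi k; have [z zP] := ind (negb \o phi) k.
    by exists z => i /zP; rewrite /=; case: (phi i) => -[].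
  exists (g \o u) => //; apply: indep_seq_inj ind'.
  by apply: disj; rewrite ltr_rat.
exfalso.
have uinj := increasing_inj uinc.
have /choice[l lP] : forall x, exists l : R,
    f (a (g (u n)) x) @[n --> \oo] --> l.
  move=> x; apply: (@oscillation_cvg R _ C) => [n|p q pq [low high]].
    exact: fC.
  have [j jE] := decP (p, q); apply: (conv j x); split=> N.
    by have [n Nn nP] := low N; exists n => //; rewrite /lowset /= jE.
  by have [n Nn nP] := high N; exists n => //; rewrite /highset /= jE.
have [infJ indJ] := indep_seq_set ginj indg.
(* By compactness a single measure has integrals alternating between the two closed levels along the
   whole subsequence; dominated convergence then forces them to converge, a contradiction. *)
have [mu muP] : exists mu : M, forall n,
    if odd n then s <= F (push_action R a (g (u n)) mu)
    else F (push_action R a (g (u n)) mu) <= r.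
  pose A := set_pair [set mu : M | F mu <= r] [set mu : M | s <= F mu].
  have clA i : closed (A i) by exact: closed_set_pair_levels cF.
  have indA : independence_set (push_action R a) A (range g).
    move=> I finI I0 IJ phi; have [mu muP] := indJ I finI I0 IJ phi.
    by exists mu => t /muP; rewrite /A /set_pair /=; case: ifP => _ /ltW.
  have cM : compact [set: M].
    exact: (@prob_measure_compact R X (metrizable_hausdorff mX) cX).
  pose phi t : 'I_2 :=
    if `[< exists2 n, g (u n) = t & odd n >] then ord_max else ord0.
  have [mu muP] := independence_point cM phi clA infJ indA.
  exists mu => n; have := muP (g (u n)) (ex_intro2 _ _ (u n) I erefl).
  have -> : phi (g (u n)) = if odd n then ord_max else ord0.
    rewrite /phi; congr (if _ then _ else _).
    by apply/asboolP/idP => [[i /ginj/uinj ->]|]; last exists n.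
  by case: (odd n).
have cvgF : F (push_action R a (g (u n)) mu) @[n --> \oo] --> \int[mu]_x l x.
  rewrite (_ : (fun n => _) = fun n => \int[mu]_x f (a (g (u n)) x)).
    2: by apply/funext => n; exact: Rintegral_push.
  apply: (@Rintegral_bounded_cvg _ _ _ mu
    (fun n x => f (a (g (u n)) x)) l C) => [n|n x|//].
    apply: (@measurable_continuous _ _ (fun x => f (a (g (u n)) x))) => x.
    exact: (continuous_comp (@action_continuous _ _ a _ x) (cf _)).
  exact: fC.
have le_r : \int[mu]_x l x <= r.
  have cv : F (push_action R a (g (u n.*2)) mu) @[n --> \oo] --> \int[mu]_x l x.
    apply: (cvg_comp double _ _ cvgF) => A [N _ NA]; exists N => // n /= Nn.
    by apply: NA; rewrite /= -addnn (leq_trans Nn)// leq_addr.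
  apply: cvgr_to_le cv _; apply: nearW => n.
  by have := muP n.*2; rewrite odd_double.
have ge_s : s <= \int[mu]_x l x.
  have cv : F (push_action R a (g (u n.*2.+1)) mu) @[n --> \oo] -->
      \int[mu]_x l x.
    apply: (cvg_comp (fun n => n.*2.+1) _ _ cvgF) => A [N _ NA].
    exists N => // n /= Nn.
    by apply: NA; rewrite /= -addnn leqW// (leq_trans Nn)// leq_addr.
  apply: cvgr_to_ge cv _; apply: nearW => n.
  by have := muP n.*2.+1; rewrite /= odd_double.
by have := lt_le_trans rs (le_trans ge_s le_r); rewrite ltxx.
Qed.

End Measures.

(** * Averages of point masses and IT-tuples *)

(** The uniform average of the Dirac masses at [w 0], ..., [w (k - 1)]. *)
Lemma average_probability (R : realType) d (T : measurableType d) (w : nat -> T)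
    (k : nat) : (0 < k)%N ->
  exists P : probability T R, forall (f : T -> R) (C : R),
    measurable_fun setT f -> (forall x, `|f x| <= C) ->
    \int[P]_x f x = (\sum_(j < k) f (w j)) / k%:R.
Proof.
move=> k0; have kR : 0 < k%:R :> R by rewrite ltr0n.
have k_ge0 : 0 <= k%:R^-1 :> R by rewrite invr_ge0.
pose m : {measure set T -> \bar R} :=
  mscale (NngNum k_ge0) (msum (fun j => \d_(w j)) k).
have mE (g : T -> R) : measurable_fun setT g -> (forall x, 0 <= g x) ->
    (\int[m]_x (g x)%:E = ((\sum_(j < k) g (w j)) / k%:R)%:E)%E.
  move=> mg g0.
  have mgE : measurable_fun setT (EFin \o g) by exact/measurable_EFinP.
  rewrite ge0_integral_mscale//; last by move=> x _; rewrite lee_fin.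
  rewrite ge0_integral_measure_sum//; last by move=> x _; rewrite lee_fin.
  rewrite /= mulrC EFinM -sumEFin; congr (_ * _)%E.
  by apply: eq_bigr => j _; rewrite integral_dirac// diracT mul1e.
have mT : m setT = 1%E.
  rewrite /m /= /mscale /= /msum (eq_bigr (fun=> 1%E)); last first.
    by move=> j _ /=; rewrite diracT.
  by rewrite sumEFin -EFinM sumr_const card_ord mulVf// gt_eqF.
pose P : probability T R := HB.pack (m : set T -> \bar R) (Measure.class m)
  (Measure_isProbability.Build _ _ _ m mT).
exists P => f C mf fC.
have g0 x : 0 <= f x + C by have := fC x; rewrite ler_norml; lra.
have mg : measurable_fun setT (fun x => f x + C).
  by apply: measurable_funD => //; exact: measurable_cst.
(* The formula [mE] needs a nonnegative integrand, hence the shift by [C]. *)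
have -> : \int[P]_x f x = \int[P]_x (1 * (f x + C) + - C).
  by apply: eq_Rintegral => x _; rewrite mul1r addrK.
rewrite (@Rintegral_affine _ _ _ P (fun x => f x + C) (C + C)) => [|//|x];
  last first.
  by have := fC x; rewrite !ler_norml => /andP[? ?]; apply/andP; split; lra.
rewrite mul1r /Rintegral mE//= big_split/= sumr_const card_ord -mulr_natr.
by field; rewrite gt_eqF.
Qed.

Lemma measurable_indic_set1 (R : realType) (X : ptopologicalType) (x : X) :
  hausdorff_space X ->
  measurable_fun [set: borel X] (\1_[set x] : borel X -> R).
Proof.
move=> hX; apply: measurable_indic; rewrite -[X in measurable X]setCK.
apply: measurableC; apply: sub_sigma_algebra; apply: closed_openC.
by apply: accessible_closed_set1; exact: hausdorff_accessible.
Qed.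

Lemma normr_indic_le1 (R : realType) (T : Type) (A : set T) x :
  `|\1_A x : R| <= 1.
Proof. by rewrite indicE; case: (_ \in _); rewrite ?normr1 ?normr0. Qed.

Section Averages.
Variables (R : realType) (X : ptopologicalType).
Hypotheses (cX : compact [set: X]) (mX : metrizable R X).
Local Notation M := (prob_measure R X).

Lemma average_prob_measure (w : nat -> X) (k : nat) : (0 < k)%N ->
  exists mu : M, forall (f : X -> R) (C : R),
    measurable_fun [set: borel X] (f : borel X -> R) ->
    (forall x, `|f x| <= C) ->
    \int[mu]_x f x = (\sum_(j < k) f (w j)) / k%:R.
Proof.
move=> k0; have [P PE] := @average_probability R _ (borel X) w k k0.
exists (prob_measure_of P) => f C mf fC; rewrite -(PE f C mf fC).
congr fine; apply: eq_measure_integral => A mA _; exact: prob_measure_ofE.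
Qed.

(** Point masses at [x] and [y] agree on all [f n], hence coincide; comparing the mass of [{x}]
    gives [x = y]. *)
Lemma continuous_separation (f : nat -> X -> R) :
  (forall n, continuous (f n)) ->
  (forall mu nu : M,
    (forall n, \int[mu]_x f n x = \int[nu]_x f n x) -> mu = nu) ->
  forall x y, (forall n, f n x = f n y) -> x = y.
Proof.
move=> cf sep x y fxy.
have [mu muE] := average_prob_measure (fun=> x) (ltn0Sn 0).
have [nu nuE] := average_prob_measure (fun=> y) (ltn0Sn 0).
have munu : mu = nu.
  apply: sep => n; have [C _ fC] := continuous_bounded cX (@cf n).
  have mf := measurable_continuous (@cf n).
  by rewrite (muE _ C mf fC) (nuE _ C mf fC) !big_ord_recl !big_ord0 fxy.
have mx : measurable_fun [set: borel X] (\1_[set x] : borel X -> R).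
  exact: measurable_indic_set1 (metrizable_hausdorff mX).
have x1 z : `|\1_[set x] z : R| <= 1 by exact: normr_indic_le1.
have := muE _ 1 mx x1; rewrite munu (nuE _ 1 mx x1) !big_ord_recl !big_ord0.
rewrite !addr0 !divr1 !indicE (mem_set (erefl : [set x] x)).
case: (boolP (y \in [set x])) => [|_ /eqP]; first by rewrite inE.
by rewrite eq_sym oner_eq0.
Qed.

(** Averaging depends continuously on its points. The averages of points taken near [x] and [y]
    generate a filter, and this filter converges weak-star to [mu]. *)
Lemma average_nbhs (x y : X) (k i : nat) (mu : M) (O : set M) : (0 < k)%N ->
  (forall f : X -> R, continuous f ->
    \int[mu]_z f z = (\sum_(j < k) f (if (j < i)%N then y else x)) / k%:R) ->
  nbhs mu O ->
  exists UV : set X * set X, [/\ nbhs x UV.1, nbhs y UV.2 &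
    forall (nu : M) (w : nat -> X),
      (forall j, (j < k)%N -> (if (j < i)%N then UV.2 else UV.1) (w j)) ->
      (forall f : X -> R, continuous f ->
        \int[nu]_z f z = (\sum_(j < k) f (w j)) / k%:R) -> O nu].
Proof.
move=> k0 muE; have kR : 0 < k%:R :> R by rewrite ltr0n.
pose S (UV : set X * set X) : set M := [set nu : M | exists2 w : nat -> X,
  (forall j, (j < k)%N -> (if (j < i)%N then UV.2 else UV.1) (w j)) &
  (forall f : X -> R, continuous f ->
    \int[nu]_z f z = (\sum_(j < k) f (w j)) / k%:R)].
pose F : set_system M := filter_from [set UV | nbhs x UV.1 /\ nbhs y UV.2] S.
have FF : Filter F.
  apply: filter_from_filter.
    by exists (setT, setT); split; exact: filterT.
  move=> [U V] [U' V'] [/= xU yV] [/= xU' yV'].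
  exists (U `&` U', V `&` V'); first by split; exact: filterI.
  move=> nu [w wP nuE].
  by split; exists w => // j /wP /=; case: ifP => _ [].
suff cvgF : F --> mu.
  move=> /cvgF[[U V] [/= xU yV] SO]; exists (U, V); split=> // nu w wP nuE.
  by apply: SO; exists w.
apply: (@prob_measure_cvg R X M F id mu FF) => f.
have cf := @cts_fun _ _ f.
apply/cvgrPdist_lt => e e0.
exists ([set z | `|f x - f z| < e], [set z | `|f y - f z| < e]).
  by split; [move/cvgrPdist_lt: (cf x)|move/cvgrPdist_lt: (cf y)]; exact.
move=> nu [w wP nuE] /=; rewrite muE// nuE// -mulrBl normrM normfV.
rewrite (ger0_norm (ltW kR)) ltr_pdivrMr// -sumrB.
apply: (le_lt_trans (ler_norm_sum _ _ _)).
rewrite -[k in ltRHS]card_ord -sum1_card natr_sum mulr_sumr.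
apply: ltr_sum.
  by apply/hasP; exists (Ordinal k0); rewrite ?mem_index_enum.
by move=> j _; rewrite mulr1; have := wP j (ltn_ord j); case: ifP.
Qed.

End Averages.

Lemma sum_ord_lt (R : realType) i k : (i <= k)%N ->
  \sum_(j < k) (if (j < i)%N then 1 else 0) = i%:R :> R.
Proof.
move=> ik; rewrite -big_mkcond.
by rewrite -(@big_ord_widen R 0 +%R i k (fun=> 1) ik) sumr_const card_ord.
Qed.

(** For a pattern [phi], choose points [z j] that each [s] sends near [y] when [j < phi s] and near
    [x] otherwise. Then [s] pushes the average of the [z j] close to [mu (phi s)]. *)
Lemma independence_IT (R : realType) (G : groupType) (X : ptopologicalType)
    (a : homeo_action G X) (x y : X) (k : nat) :
  compact [set: X] -> metrizable R X -> x <> y ->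
  (forall U V, nbhs x U -> nbhs y V -> indep_pair a U V) -> (0 < k)%N ->
  (IT (push_action R a) k `\` Delta2 k (prob_measure R X)) !=set0.
Proof.
move=> cX mX xy ind k0; have kR : 0 < k%:R :> R by rewrite ltr0n.
have /choice[mu muE] := fun i => average_prob_measure R
  (fun j => if (j < i)%N then y else x) k0.
have muC i (f : X -> R) : continuous f ->
    \int[mu i]_z f z = (\sum_(j < k) f (if (j < i)%N then y else x)) / k%:R.
  move=> cf; have [C _ fC] := continuous_bounded cX cf.
  exact: muE (measurable_continuous cf) fC.
exists (fun i : 'I_k => mu i); split; last first.
  move=> [n [m [nm mu_nm]]].
  have my : measurable_fun [set: borel X] (\1_[set y] : borel X -> R).
    exact: measurable_indic_set1 (metrizable_hausdorff mX).
  have y1 z : `|\1_[set y] z : R| <= 1 by exact: normr_indic_le1.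
  (* The mass of [{y}] tells the measures [mu i] apart. *)
  have intE (i : 'I_k) : \int[mu i]_z (\1_[set y] z : R) = i%:R / k%:R.
    rewrite (muE i _ 1 my y1); congr (_ / _).
    rewrite (eq_bigr (fun j : 'I_k => if (j < i)%N then 1 else 0)) => [|j _].
      exact/sum_ord_lt/ltnW.
    by rewrite indicE; case: ifP => _; [rewrite mem_set|rewrite memNset].
  apply: nm; apply: val_inj; apply/eqP; rewrite -(eqr_nat R).
  have kV : k%:R^-1 != 0 :> R by rewrite invr_eq0 gt_eqF.
  by rewrite -(inj_eq (mulIf kV)) -!intE mu_nm.
move=> U UP.
have /choice[UV UVP] := fun i : 'I_k => average_nbhs k0 (@muC i) (UP i).
pose V1 := [set z | forall i : 'I_k, (UV i).1 z].
pose V2 := [set z | forall i : 'I_k, (UV i).2 z].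
have xV1 : nbhs x V1 by apply: filter_forall => i; case: (UVP i).
have yV2 : nbhs y V2 by apply: filter_forall => i; case: (UVP i).
have [g ginj indg] := ind V1 V2 xV1 yV2.
have [infJ indJ] := indep_seq_set ginj indg.
exists (range g) => // I finI I0 IJ phi.
have /choice[z zP] := fun j : nat => indJ I finI I0 IJ
  (fun s => if (j < phi s)%N then ord_max else ord0).
have [nu nuE] := average_prob_measure R z k0.
exists nu => s Is /=; have [_ _ /(_ _ (a s \o z))] := UVP (phi s); apply.
  move=> j jk /=; have := zP j s Is; rewrite /preimage /mkset set_pairE.
  by case: ifP => _ /(_ (phi s)).
move=> f cf; rewrite Rintegral_push//.
have cfa : continuous (fun x => f (a s x)).
  by move=> t; exact: (continuous_comp (@action_continuous _ _ a s t) (cf _)).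
have [C _ fC] := continuous_bounded cX cfa.
exact: nuE (measurable_continuous cfa) fC.
Qed.

(** * Assembling the equivalences *)

Section MainEquivalence.
Variables (R : realType) (G : groupType) (X : ptopologicalType).
Variable (a : homeo_action G X).
Hypotheses (cG : countable [set: G]) (cX : compact [set: X]).
Hypothesis (mX : metrizable R X).
Local Notation M := (prob_measure R X).

Definition has_independence := exists2 f : X -> R, continuous f &
  exists p q : rat, p < q /\
    indep_pair a [set x | f x < ratr p] [set x | ratr q < f x].

Let level_disjoint (T : Type) (h : T -> R) (p q : R) : p < q ->
  [set t | h t <= p] `&` [set t | q <= h t] = set0.
Proof.
move=> pq; apply/seteqP; split=> // t [/= tp qt].
by have := lt_le_trans pq (le_trans qt tp); rewrite ltxx.
Qed.

Lemma continuous_int (f : X -> R) : continuous f ->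
  continuous (fun mu : M => \int[mu]_x f x).
Proof. by move=> cf; exact: (@integral_continuous R X (mkcts cf)). Qed.

Lemma not_tame_has_independence : ~ tame a -> has_independence.
Proof.
have [f [cf sepf]] := separating_functions cX mX.
have sepX := continuous_separation cX mX cf sepf.
move=> /(not_tame_indep cf sepX cG)[i [r [s [rs [g indg]]]]].
exists (f i); first exact: cf.
exists r, s; split=> //; exists g => //; apply: indep_seq_inj indg.
apply: (subsetI_eq0 _ _ (@level_disjoint _ (f i) (ratr r) (ratr s) _)).
- by move=> t /ltW.
- by move=> t /ltW.
- by rewrite ltr_rat.
Qed.

Lemma push_not_tame_has_independence :
  ~ tame (push_action R a) -> has_independence.
Proof.
have [f [cf sepf]] := separating_functions cX mX.
move=> /(@not_tame_indep R G M (push_action R a) (fun i mu => \int[mu]_x f i x)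
  (fun i => continuous_int (@cf i)) sepf cG)[i [r [s [rs [g indg]]]]].
exists (f i); first exact: cf.
have rsR : ratr r < ratr s :> R by rewrite ltr_rat.
apply: (@indep_integral R G X a cX mX (f i) _ _ g (@cf i) rsR).
exact: indg.
Qed.

(** Enlarging to closed level sets keeps independence, and [p < q] keeps them disjoint. *)
Lemma has_independence_not_tame : has_independence -> ~ tame a.
Proof.
move=> [f cf [p [q [pq [g ginj indg]]]]].
have [infJ indJ] := indep_seq_set ginj indg.
apply: (@infinite_independence_not_tame G X a cX
  (set_pair [set x | f x <= ratr p] [set x | ratr q <= f x]) (range g)) => //.
- by move=> i; exact: closed_set_pair_levels.
- by rewrite /set_pair /=; apply: level_disjoint; rewrite ltr_rat.
- move=> I finI I0 IJ phi; have [x xP] := indJ I finI I0 IJ phi.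
  by exists x => t /xP; rewrite /set_pair /=; case: ifP => _ /ltW.
Qed.

Lemma has_independence_IT : has_independence -> forall k, (2 <= k)%N ->
  (IT (push_action R a) k `\` Delta2 k M) !=set0.
Proof.
move=> [f cf [p [q [pq ind]]]] k k2.
have cl (A : set R) : closed A -> compact (f @^-1` A).
  move=> cA; apply: (subclosed_compact _ cX) => //.
  by apply: closed_comp => // ? _; exact: cf.
have {ind} ind : indep_pair a (f @^-1` [set y | y <= ratr p])
    (f @^-1` [set y | ratr q <= y]).
  by apply: indep_pair_subset ind => x /ltW.
have [x [y [xp yq xy]]] :=
  indep_points (cl _ (@closed_le _ _)) (cl _ (@closed_ge _ _)) ind.
apply: (independence_IT cX mX _ xy); last exact: leq_trans k2.
move=> E; rewrite -E in yq; have [] // : set0 x.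
by rewrite -(@level_disjoint _ f (ratr p) (ratr q)) ?ltr_rat.
Qed.

(** Some integral separates the two distinct measures, so disjoint closed level sets are
    neighborhoods of them and have an infinite independence set. *)
Lemma IT_push_not_tame :
  (IT (push_action R a) 2 `\` Delta2 2 M) !=set0 -> ~ tame (push_action R a).
Proof.
move=> [z [ITz nDz]].
have [f [cf sepf]] := separating_functions cX mX.
have [i zi] : exists i, \int[z ord0]_x f i x <> \int[z ord_max]_x f i x.
  apply/not_existsP => zE; apply: nDz; exists ord0, ord_max; split=> //.
  by apply: sepf => n; apply: contrapT; exact: zE.
have [h [ch h01]] : exists h : M -> R,
    continuous h /\ h (z ord0) < h (z ord_max).
  have [lt01|le10] := ltP (\int[z ord0]_x f i x) (\int[z ord_max]_x f i x).
    exists (fun mu : M => \int[mu]_x f i x); split=> //.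
    exact: continuous_int.
  exists (fun mu : M => - \int[mu]_x f i x); split.
    move=> mu; have ci := @continuous_int (f i) (@cf i) mu; exact: (cvgN ci).
  by rewrite ltrN2 lt_neqAle le10 andbT; apply/eqP => /esym.
(* [r] and [s] cut the interval between the two values of [h] into thirds. *)
pose r := (2 * h (z ord0) + h (z ord_max)) / 3.
pose s := (h (z ord0) + 2 * h (z ord_max)) / 3.
have [zr rs sz] : [/\ h (z ord0) < r, r < s & s < h (z ord_max)].
  by split; rewrite /r /s; lra.
pose A := set_pair [set mu | h mu <= r] [set mu | s <= h mu].
have nA j : nbhs (z j) (A j).
  rewrite /A /set_pair; case: eqP => [->|/eqP j0].
    by apply: filterS (cvgr_lt _ (@ch (z ord0)) _ zr) => mu /ltW.
  have -> : j = ord_max by apply: val_inj; case: j j0 => [[|[|]]].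
  by apply: filterS (cvgr_gt _ (@ch (z ord_max)) _ sz) => mu /ltW.
have [J infJ indJ] := ITz A nA.
apply: (@infinite_independence_not_tame G M (push_action R a) _ A J
  _ _ infJ indJ).
- exact: (@prob_measure_compact R X (metrizable_hausdorff mX) cX).
- by move=> j; exact: closed_set_pair_levels.
- by rewrite /A /set_pair /=; exact: level_disjoint.
Qed.

End MainEquivalence.

Theorem theorem4p35 (R : realType) (G : groupType) (X : ptopologicalType)
    (a : homeo_action G X) :
  countable [set: G] -> infinite_set [set: G] ->
  compact [set: X] -> metrizable R X ->
  (~ tame a <-> ~ tame (push_action R a)) /\
  (~ tame (push_action R a) <->
   forall k : nat, (2 <= k)%N ->
     (IT (push_action R a) k `\` Delta2 k (prob_measure R X)) !=set0).
Proof.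
move=> cG _ cX mX; split; split.
(* Independence on [X] reaches the space of measures through IT-pairs, that is, the case [k = 2]. *)
- move=> /(not_tame_has_independence cG cX mX)/(has_independence_IT cX mX) it.
  exact: IT_push_not_tame cX mX (it 2 isT).
- move=> /(push_not_tame_has_independence cG cX mX).
  exact: has_independence_not_tame.
- move=> /(push_not_tame_has_independence cG cX mX).
  exact: has_independence_IT.
- by move=> it; exact: IT_push_not_tame cX mX (it 2 isT).
Qed.
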